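(* For both the Plurality rule and the Condorcet rule, C-Des-Del is fixed-parameter tractable with respect to the number $m$ of candidates if the bundling function $\kappa$ is anonymous.
   Context: An election $(C,V)$: finite candidate set $C$ ($|C|=m$) and finite voter set $V$, each voter having a strict linear preference order $\succ_v$ over $C$ (his favorite is the top candidate). Plurality: $c$ is a winner if the number of voters with favorite $c$ is at least that of every other candidate. Condorcet: $c$ is a Condorcet winner if for every $c'\ne c$, $|\{v: c\succ_v c'\}|>|\{v: c'\succ_v c\}|$; the Condorcet rule returns the set containing the unique Condorcet winner if it exists and the empty set otherwise; a candidate is a winner under this rule if it is returned. A bundling function on $V$ is $\kappa:V\to2^V$ with $v\in\kappa(v)$; $\kappa(V')=\bigcup_{v\in V'}\kappa(v)$. $\kappa$ is anonymous if for any two distinct voters $x,y$ with the same preferences (the same preference order), $\kappa(x)=\kappa(y)$ and, for every other voter $z$, $x\in\kappa(z)$ iff $y\in\kappa(z)$. For a voting rule $\mathcal R$, C-Des-Del: given $(C,V)$, $\kappa:V\to2^V$, $p\in C$, $k\in\mathbb{N}$, decide whether some $V'\subseteq V$ with $|V'|\le k$ makes $p$ not a winner of $(C,V\setminus\kappa(V'))$ under $\mathcal R$. *)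

(* Defs.v *)
From mathcomp Require Import all_boot all_order all_fingroup.
Set Implicit Arguments.
Unset Strict Implicit.
Unset Printing Implicit Defensive.

(* Machine model: a deterministic unit-cost RAM (registers hold nats,  *)
(* indirect addressing, addition and truncated subtraction only; no    *)
(* multiplication, so it is polynomially equivalent to Turing machines *)
(* and "polynomial"/"FPT" running times have their usual meaning).      *)

Inductive instr : Type :=
  | IConst of nat & nat
  | IAdd of nat & nat & nat
  | ISub of nat & nat & nat
  | ILoad of nat & nat
  | IStore of nat & nat
  | IJz of nat & nat
  | IHalt of nat.

Definition program := seq instr.
Definition memory := nat -> nat.
Definition config : Type := (nat * memory)%type.

Definition upd (mem : memory) (i v : nat) : memory :=
  fun j => if j == i then v else mem j.

(* Fetching outside the program halts with output R[0]. *)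
Definition fetch (P : program) (pc : nat) : instr := nth (IHalt 0) P pc.

Definition step (P : program) (c : config) : option config :=
  let: (pc, mem) := c in
  match fetch P pc with
  | IConst r v => Some (pc.+1, upd mem r v)
  | IAdd r a b => Some (pc.+1, upd mem r (mem a + mem b))
  | ISub r a b => Some (pc.+1, upd mem r (mem a - mem b))
  | ILoad r a => Some (pc.+1, upd mem r (mem (mem a)))
  | IStore a r => Some (pc.+1, upd mem (mem a) (mem r))
  | IJz r l => Some (if mem r == 0 then l else pc.+1, mem)
  | IHalt _ => None
  end.

Definition halt_output (P : program) (c : config) : option nat :=
  let: (pc, mem) := c in
  match fetch P pc with IHalt r => Some (mem r) | _ => None end.

Fixpoint run (P : program) (t : nat) (c : config) : option config :=
  match t with
  | 0 => Some c
  | t'.+1 => match step P c with Some c' => run P t' c' | None => None end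
  end.

Definition init (input : seq nat) : config :=
  (0, fun i => if i == 0 then size input else nth 0 input i.-1).

Definition halts_with (P : program) (input : seq nat) (t out : nat) : Prop :=
  exists c, run P t (init input) = Some c /\ halt_output P c = Some out.

(* Candidates C = 'I_m, voters V = 'I_n.  The preference order of      *)
(* voter v is given by the permutation [pref v] : position -> candidate *)
(* (position 0 = favourite).                                           *)

Record instance : Type := Instance {
  inst_m : nat;
  inst_n : nat;
  inst_pref : 'I_inst_n -> {perm 'I_inst_m};
  inst_kappa : 'I_inst_n -> {set 'I_inst_n};
  inst_p : 'I_inst_m;
  inst_k : nat }.

Arguments inst_pref i _ : clear implicits.
Arguments inst_kappa i _ : clear implicits.
Arguments inst_p i : clear implicits.

Section Elections.
Variables (m n : nat) (pref : 'I_n -> {perm 'I_m}).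

Definition pos (v : 'I_n) (c : 'I_m) : nat := val ((pref v)^-1%g c).

Definition prefers (v : 'I_n) (c c' : 'I_m) : bool := pos v c < pos v c'.

Definition favourite (v : 'I_n) (c : 'I_m) : bool := pos v c == 0.

Definition plurality_score (W : {set 'I_n}) (c : 'I_m) : nat :=
  #|[set v in W | favourite v c]|.

Definition plurality_winner (W : {set 'I_n}) (c : 'I_m) : Prop :=
  forall c' : 'I_m, plurality_score W c' <= plurality_score W c.

Definition condorcet_winner (W : {set 'I_n}) (c : 'I_m) : Prop :=
  forall c' : 'I_m, c' != c ->
    #|[set v in W | prefers v c' c]| < #|[set v in W | prefers v c c']|.

End Elections.

Inductive voting_rule : Type := Plurality | Condorcet.

(* c is a winner of the election (C, W) under the rule. For Condorcet the
   rule returns {the Condorcet winner} or the empty set, so c is a winner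
   iff c is the Condorcet winner. *)
Definition is_winner (R : voting_rule) (m n : nat) (pref : 'I_n -> {perm 'I_m})
    (W : {set 'I_n}) (c : 'I_m) : Prop :=
  match R with
  | Plurality => plurality_winner pref W c
  | Condorcet => condorcet_winner pref W c
  end.

Definition bundle_union (n : nat) (kappa : 'I_n -> {set 'I_n}) (V' : {set 'I_n})
  : {set 'I_n} := \bigcup_(v in V') kappa v.

Definition is_bundling (n : nat) (kappa : 'I_n -> {set 'I_n}) : Prop :=
  forall v, v \in kappa v.

Definition anonymous (m n : nat) (pref : 'I_n -> {perm 'I_m})
    (kappa : 'I_n -> {set 'I_n}) : Prop :=
  forall x y : 'I_n, x != y -> pref x = pref y ->
    kappa x = kappa y /\
    (forall z : 'I_n, z != x -> z != y -> (x \in kappa z) = (y \in kappa z)).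

Definition CDesDel (R : voting_rule) (I : instance) : Prop :=
  exists V' : {set 'I_(inst_n I)},
    #|V'| <= inst_k I /\
    ~ is_winner R (inst_pref I)
        (~: bundle_union (inst_kappa I) V') (inst_p I).

Definition encode (I : instance) : seq nat :=
  [:: inst_m I; inst_n I; val (inst_p I); inst_k I] ++
  flatten [seq [seq val (inst_pref I v i) | i <- enum 'I_(inst_m I)]
          | v <- enum 'I_(inst_n I)] ++
  flatten [seq [seq nat_of_bool (u \in inst_kappa I v) | u <- enum 'I_(inst_n I)]
          | v <- enum 'I_(inst_n I)].

Definition computable (f : nat -> nat) : Prop :=
  exists F : program, forall x, exists t, halts_with F [:: x] t (f x).

Definition FPT (L dom : instance -> Prop) (param : instance -> nat) : Prop :=
  exists (P : program) (f : nat -> nat) (c : nat),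
    computable f /\
    forall I, dom I ->
      exists t out,
        t <= f (param I) * (size (encode I)) ^ c /\
        halts_with P (encode I) t out /\
        ((L I /\ out = 1) \/ (~ L I /\ out = 0)).

(* Main.v *)
(* If two voters have equal bundles, then only one of them needs to be chosen,
   since replacing the chosen voters by representatives of their bundles keeps
   the deleted set and does not increase the number of chosen voters.  Under
   anonymity the bundle depends only on the preference order, so there are at
   most m! representatives, and trying the at most 2 ^ m! sets of
   representatives, each in polynomial time, decides the problem.  To run this
   on the RAM, the algorithm is written in a loop language whose programs all
   terminate; a compiler to the RAM is proved correct once, together with a
   bound on the number of steps that is read off the source program. *)

Require Import Defs.
From mathcomp Require Import all_boot all_order all_fingroup.
From mathcomp Require Import zify.
Set Implicit Arguments.
Unset Strict Implicit.
Unset Printing Implicit Defensive.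

(** * A loop language and its compiler *)

(** The program compares rows of the bundling matrix, never preference orders; anonymity enters
    where the number of distinct rows is bounded by m!. The subsets are visited by a binary counter
    whose digits sit at the representatives, so moving to the next subset takes one scan of the
    voters. [FPT] asks for a bound that is itself computable on the RAM: 2 ^ 2 ^ 2 ^ m * (m + 1) is
    chosen because m! <= 2 ^ 2 ^ m and towers of two need only repeated doubling. The factor m + 1
    pays for trying every rival of p; m cannot be charged to the length of the input, which is 4 for
    every m when there are no voters. *)

Record state := State { env : nat -> nat; arr : nat -> nat -> nat }.

Definition setv (s : state) (x v : nat) : state := State (upd (env s) x v) (arr s).

Definition seta (s : state) (a i v : nat) : state :=
  State (env s) (fun a' => if a' == a then upd (arr s a) i v else arr s a').

Inductive expr : Type :=
  | EVar of nat
  | ENum of nat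
  | EAdd of expr & expr
  | ESub of expr & expr
  | EGet of nat & expr.

Fixpoint eval (s : state) (e : expr) : nat :=
  match e with
  | EVar x => env s x
  | ENum c => c
  | EAdd e1 e2 => eval s e1 + eval s e2
  | ESub e1 e2 => eval s e1 - eval s e2
  | EGet a e1 => arr s a (eval s e1)
  end.

Inductive cmd : Type :=
  | Assign of nat & expr
  | Put of nat & expr & expr
  | Seq of cmd & cmd
  | If of expr & cmd
  | For of nat & nat & cmd.

(** A loop reads its bound once, on entry, and rewrites its counter after every pass, so termination
    holds by construction. *)
Fixpoint exec (c : cmd) (s : state) : state :=
  match c with
  | Assign x e => setv s x (eval s e)
  | Put a e1 e2 => seta s a (eval s e1) (eval s e2)
  | Seq c1 c2 => exec c2 (exec c1 s)
  | If e c1 => if eval s e == 0 then s else exec c1 s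
  | For x y c1 =>
      iteri (env s y) (fun i t => setv (exec c1 t) x i.+1) (setv s x 0)
  end.

Fixpoint assigned (c : cmd) : seq nat :=
  match c with
  | Assign x _ => [:: x]
  | Put _ _ _ => [::]
  | Seq c1 c2 => assigned c1 ++ assigned c2
  | If _ c1 => assigned c1
  | For x _ c1 => x :: assigned c1
  end.

Fixpoint updated (c : cmd) : seq nat :=
  match c with
  | Assign _ _ => [::]
  | Put a _ _ => [:: a]
  | Seq c1 c2 => updated c1 ++ updated c2
  | If _ c1 => updated c1
  | For _ _ c1 => updated c1
  end.

Fixpoint bounds (c : cmd) : seq nat :=
  match c with
  | Assign _ _ | Put _ _ _ => [::]
  | Seq c1 c2 => bounds c1 ++ bounds c2
  | If _ c1 => bounds c1
  | For _ y c1 => y :: bounds c1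
  end.

(** Frame relation: it carries values across a fragment by a membership check, without analysing
    what the fragment computes. *)
Definition agree (xs as_ : seq nat) (s t : state) : Prop :=
  (forall x, x \notin xs -> env t x = env s x) /\
  (forall a, a \notin as_ -> arr t a = arr s a).

Lemma agree_trans xs as_ s t u :
  agree xs as_ s t -> agree xs as_ t u -> agree xs as_ s u.
Proof.
move=> [e1 a1] [e2 a2]; split=> [x hx|a ha]; first by rewrite e2 // e1.
by rewrite a2 // a1.
Qed.

Lemma agree_sub xs as_ xs' as' s t :
  {subset xs <= xs'} -> {subset as_ <= as'} -> agree xs as_ s t -> agree xs' as' s t.
Proof.
move=> hx ha [e a]; split=> [x nx|b nb]; first by apply: e; apply: contra nx => /hx.
by apply: a; apply: contra nb => /ha.
Qed.

Lemma agree_setv xs as_ s x v : x \in xs -> agree xs as_ s (setv s x v).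
Proof.
move=> hx; split=> // z; rewrite /= /upd.
by case: eqP => // -> ; rewrite hx.
Qed.

Lemma exec_agree c s : agree (assigned c) (updated c) s (exec c s).
Proof.
elim: c s => [x e|a e1 e2|c1 ih1 c2 ih2|e c ih|x y c ih] s /=.
- by apply: agree_setv; rewrite inE.
- split=> // b; rewrite inE /= => /negPf hb.
  by rewrite hb.
- apply: (agree_trans (t := exec c1 s)).
    by apply: agree_sub (ih1 s) => z hz; rewrite mem_cat hz.
  by apply: agree_sub (ih2 _) => z hz; rewrite mem_cat hz orbT.
- by case: ifP => // _.
- elim: (env s y) => [|n ihn] /=; first by apply: agree_setv; rewrite inE eqxx.
  apply: (agree_trans ihn); set t := iteri _ _ _.
  apply: (agree_trans (t := exec c t)); last by apply: agree_setv; rewrite inE eqxx.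
  by apply: agree_sub (ih t) => // z hz; rewrite inE hz orbT.
Qed.

(** Each pass may assume, besides the invariant, the value of the counter and agreement with the
    state before the loop; invariants therefore mention only what the loop changes. *)
Lemma for_rule (Inv : nat -> state -> Prop) x y c s :
  Inv 0 (setv s x 0) ->
  (forall i t, i < env s y -> env t x = i -> agree (x :: assigned c) (updated c) s t ->
     Inv i t -> Inv i.+1 (setv (exec c t) x i.+1)) ->
  Inv (env s y) (exec (For x y c) s).
Proof.
move=> h0 hS /=.
suff H n : n <= env s y ->
    let t := iteri n (fun i t => setv (exec c t) x i.+1) (setv s x 0) in
    [/\ env t x = n, agree (x :: assigned c) (updated c) s t & Inv n t].
  by case: (H _ (leqnn _)).
elim: n => [|n ih] hn /=.
  split=> //; first by rewrite /upd eqxx.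
  by apply: agree_setv; rewrite inE eqxx.
case: (ih (ltnW hn)); set t := iteri _ _ _ => h1 h2 h3; split.
- by rewrite /upd eqxx.
- apply: (agree_trans h2); apply: (agree_trans (t := exec c t)).
    by apply: agree_sub (exec_agree c t) => // z hz; rewrite inE hz orbT.
  by apply: agree_setv; rewrite inE eqxx.
- exact: hS.
Qed.

(* Memory layout of compiled programs: variable x lives in register x (2 < x < 32),
   expressions are evaluated on a stack starting at register 32 and ending before
   64, and register 2 holds a base address B >= 64 such that cell i of array a < 8
   is at address B + 8 * i + a.  Interleaving the arrays makes all of them
   unbounded. *)
Definition addr (t a : nat) : program :=
  [:: IAdd t t t; IAdd t t t; IAdd t t t; IConst t.+1 a; IAdd t t t.+1; IAdd t t 2].

(** [t] is both the result register and the top of the stack: the left operand stays in [t] while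
    the right one is evaluated from [t.+1]. A move is a clearing followed by an addition. *)
Fixpoint cexpr (t : nat) (e : expr) : program :=
  match e with
  | EVar x => [:: IConst t 0; IAdd t t x]
  | ENum c => [:: IConst t c]
  | EAdd e1 e2 => cexpr t e1 ++ cexpr t.+1 e2 ++ [:: IAdd t t t.+1]
  | ESub e1 e2 => cexpr t e1 ++ cexpr t.+1 e2 ++ [:: ISub t t t.+1]
  | EGet a e1 => cexpr t e1 ++ addr t a ++ [:: ILoad t t]
  end.

(** Jump targets are absolute, hence the parameter [pc]. An unconditional jump is [IJz] on a freshly
    cleared register. The loop test is the truncated difference of bound and counter, which vanishes
    once the counter reaches the bound. *)
Fixpoint ccmd (pc : nat) (c : cmd) : program :=
  match c with
  | Assign x e => cexpr 32 e ++ [:: IConst x 0; IAdd x x 32]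
  | Put a e1 e2 => cexpr 32 e1 ++ addr 32 a ++ cexpr 33 e2 ++ [:: IStore 32 33]
  | Seq c1 c2 => let p1 := ccmd pc c1 in p1 ++ ccmd (pc + size p1) c2
  | If e c1 =>
      let p0 := cexpr 32 e in
      let p1 := ccmd (pc + size p0 + 1) c1 in
      p0 ++ IJz 32 (pc + size p0 + 1 + size p1) :: p1
  | For x y c1 =>
      let p1 := ccmd (pc + 3) c1 in
      [:: IConst x 0; ISub 32 y x; IJz 32 (pc + 3 + size p1 + 4)] ++ p1 ++
      [:: IConst 32 1; IAdd x x 32; IConst 32 0; IJz 32 (pc + 1)]
  end.

Definition isvar (x : nat) : bool := 2 < x < 32.

Fixpoint wfe (t : nat) (e : expr) : bool :=
  match e with
  | EVar x => isvar x && (t < 64)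
  | ENum _ => t < 64
  | EAdd e1 e2 | ESub e1 e2 => wfe t e1 && wfe t.+1 e2
  | EGet a e1 => [&& a < 8, t.+1 < 64 & wfe t e1]
  end.

Definition apart (s1 s2 : seq nat) : bool := ~~ has (mem s1) s2.

(* No loop bound is modified before or inside its loop, so that all bounds can
   be read off the initial environment. *)
Fixpoint wf (c : cmd) : bool :=
  match c with
  | Assign x e => isvar x && wfe 32 e
  | Put a e1 e2 => [&& a < 8, wfe 32 e1 & wfe 33 e2]
  | Seq c1 c2 => [&& wf c1, wf c2 & apart (assigned c1) (bounds c2)]
  | If e c1 => wfe 32 e && wf c1
  | For x y c1 => [&& isvar x, isvar y, x \notin assigned c1, wf c1 &
                   apart (x :: assigned c1) (y :: bounds c1)]
  end.

(** Loop bounds are read from one fixed valuation, which [wf] justifies. In a loop, 6 counts the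
    test, the increment and the jump back of one pass; 3 counts the initialisation and the last
    test. *)
Fixpoint cost (c : cmd) (r : nat -> nat) : nat :=
  match c with
  | Assign x e => size (cexpr 32 e) + 2
  | Put a e1 e2 => size (cexpr 32 e1) + 6 + size (cexpr 33 e2) + 1
  | Seq c1 c2 => cost c1 r + cost c2 r
  | If e c1 => size (cexpr 32 e) + 1 + cost c1 r
  | For _ y c1 => r y * (cost c1 r + 6) + 3
  end.

Lemma eq_cost c r r' : {in bounds c, r =1 r'} -> cost c r = cost c r'.
Proof.
elim: c => //= [c1 ih1 c2 ih2|e c ih|x y c ih] h.
- by rewrite ih1 1?ih2 // => z hz; apply: h; rewrite mem_cat hz ?orbT.
- by rewrite ih.
- by rewrite (h y) ?inE ?eqxx // ih // => z hz; apply: h; rewrite inE hz orbT.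
Qed.

Lemma cost_agree c xs as_ s t :
  agree xs as_ s t -> apart xs (bounds c) -> cost c (env t) = cost c (env s).
Proof.
move=> [h _] /hasPn hd; apply: eq_cost => y hy; apply: h; exact: hd.
Qed.

(** * Running code fragments on the RAM *)

Definition code_at (P : program) (pc : nat) (code : program) : Prop :=
  exists P1 P2, P = P1 ++ code ++ P2 /\ size P1 = pc.

Lemma code_at_cat P pc p1 p2 :
  code_at P pc (p1 ++ p2) -> code_at P pc p1 /\ code_at P (pc + size p1) p2.
Proof.
move=> [P1 [P2 [-> <-]]]; split; first by exists P1, (p2 ++ P2); rewrite -catA.
by exists (P1 ++ p1), P2; rewrite size_cat -!catA.
Qed.

Lemma code_at_fetch P pc i p : code_at P pc (i :: p) -> fetch P pc = i.
Proof. by move=> [P1 [P2 [-> <-]]]; rewrite /fetch nth_cat ltnn subnn. Qed.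

Lemma run_cat P t1 t2 c c' c'' :
  run P t1 c = Some c' -> run P t2 c' = Some c'' -> run P (t1 + t2) c = Some c''.
Proof.
elim: t1 c => [|t1 ih] c /=; first by case=> ->.
by case: (step P c) => // d h1 h2; apply: ih.
Qed.

Definition effect (i : instr) (mem : memory) : memory :=
  match i with
  | IConst r v => upd mem r v
  | IAdd r a b => upd mem r (mem a + mem b)
  | ISub r a b => upd mem r (mem a - mem b)
  | ILoad r a => upd mem r (mem (mem a))
  | IStore a r => upd mem (mem a) (mem r)
  | IJz _ _ | IHalt _ => mem
  end.

Definition straight (i : instr) : bool :=
  match i with IJz _ _ | IHalt _ => false | _ => true end.

(** A jump-free block is executed in one go, and the resulting memory is then obtained by
    computation. *)
Lemma run_straight P pc code mem :
  code_at P pc code -> all straight code ->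
  run P (size code) (pc, mem)
  = Some (pc + size code, foldl (fun m i => effect i m) mem code).
Proof.
elim: code pc mem => [|i code ih] pc mem /=; first by rewrite addn0.
move=> hat /andP [hi hc]; have hf := code_at_fetch hat.
rewrite -cat1s in hat; case: (code_at_cat hat) => _ hat' {hat}.
rewrite /= addn1 in hat'; rewrite addnS -addSn hf.
by case: i hi hf => //= *; rewrite (ih _ _ hat' hc).
Qed.

Lemma run_jz P pc r l p mem :
  code_at P pc (IJz r l :: p) ->
  run P 1 (pc, mem) = Some (if mem r == 0 then l else pc.+1, mem).
Proof. by move=> /code_at_fetch /= ->. Qed.

(** Registers 0 and 1, the stack area 32 to 63 and the cells from 64 up to the base are
    unconstrained, so scratch values may be written to the stack freely. *)
Definition represents (B : nat) (mem : memory) (s : state) : Prop :=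
  [/\ 64 <= B, mem 2 = B, forall x, isvar x -> mem x = env s x
    & forall a i, a < 8 -> mem (B + 8 * i + a) = arr s a i].

Lemma represents_temp B mem mem' s :
  represents B mem s -> (forall j, j < 32 \/ 64 <= j -> mem' j = mem j) ->
  represents B mem' s.
Proof.
move=> [hB h2 hv ha] h; split=> //.
- by rewrite h //; left.
- by move=> x hx; rewrite h ?hv //; left; case/andP: hx.
- by move=> a i hi; rewrite h ?ha //; right; lia.
Qed.

Lemma represents_setv B mem mem' s x v :
  isvar x -> represents B mem s -> mem' x = v ->
  (forall j, j != x -> j < 32 \/ 64 <= j -> mem' j = mem j) ->
  represents B mem' (setv s x v).
Proof.
move=> /andP [x1 x2] [hB h2 hv ha] hx h; split=> //.
- by rewrite h //; lia.
- move=> y hy; rewrite /= /upd; case: eqP => [->//|hyx]; rewrite h ?hv //; first by lia.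
  by case/andP: hy; lia.
- by move=> a i hi; rewrite h ?ha //; lia.
Qed.

Lemma represents_seta B mem mem' s a i v :
  a < 8 -> represents B mem s -> mem' (B + 8 * i + a) = v ->
  (forall j, j != B + 8 * i + a -> j < 32 \/ 64 <= j -> mem' j = mem j) ->
  represents B mem' (seta s a i v).
Proof.
move=> hi [hB h2 hv ha] hx h; split=> //.
- by rewrite h //; lia.
- by move=> y hy; rewrite h ?hv //; case/andP: hy; lia.
- move=> b j hb; rewrite /= /upd; case: (eqVneq b a) => [->|hab].
    case: (eqVneq j i) => [->//|hij].
    by rewrite h ?ha //; lia.
  by rewrite h ?ha //; lia.
Qed.

Lemma addr_correct P pc t a mem :
  2 < t -> code_at P pc (addr t a) ->
  exists mem', [/\ run P 6 (pc, mem) = Some (pc + 6, mem'),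
    mem' t = mem 2 + 8 * mem t + a
  & forall j, j != t -> j != t.+1 -> mem' j = mem j].
Proof.
move=> ht hat; eexists; split.
- exact: (run_straight mem hat isT).
- rewrite /addr /= /upd !eqxx; have -> : (2 == t) = false by lia.
  have -> : (2 == t.+1) = false by lia.
  have -> : (t == t.+1) = false by lia.
  lia.
- by move=> j /negPf h1 /negPf h2; rewrite /addr /= /upd h1 h2.
Qed.

Lemma wfe_lt t e : wfe t e -> t < 64.
Proof.
elim: e t => [x|c|e1 ih1 e2 _|e1 ih1 e2 _|a e ih] t //=.
- by case/andP.
- by case/andP=> /ih1.
- by case/andP=> /ih1.
- by case/and3P=> _ _ /ih.
Qed.

(** Preserving what lies below [t] keeps the pending operands of enclosing expressions alive;
    preserving what lies from 64 on protects the arrays. *)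
Lemma cexpr_correct P B s e t pc mem :
  31 < t -> wfe t e -> represents B mem s -> code_at P pc (cexpr t e) ->
  exists mem', [/\ run P (size (cexpr t e)) (pc, mem) = Some (pc + size (cexpr t e), mem'),
    mem' t = eval s e
  & forall j, j < t \/ 64 <= j -> mem' j = mem j].
Proof.
elim: e t pc mem => [x|c|e1 ih1 e2 ih2|e1 ih1 e2 ih2|a e ih] t pc mem ht hwf hrep hat.
- case/andP: hwf => hx htt; eexists; split; first exact: (run_straight mem hat isT).
    rewrite /= /upd eqxx; case/andP: (hx) => _ hx2.
    have -> : (x == t) = false by lia.
    by case: hrep => _ _ -> //.
  by move=> j hj; rewrite /= /upd; have -> : (j == t) = false by lia.
- eexists; split; first exact: (run_straight mem hat isT).
    by rewrite /= /upd eqxx.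
  by move=> j hj; rewrite /= /upd; have -> : (j == t) = false by move: hwf => /=; lia.
- move: hwf hat => /= /andP [w1 w2] /code_at_cat [a1 /code_at_cat [a2 a3]].
  have [mem1 [r1 v1 f1]] := ih1 _ _ _ ht w1 hrep a1.
  have hrep1 : represents B mem1 s.
    by apply: represents_temp hrep _ => j hj; apply: f1; lia.
  have [mem2 [r2 v2 f2]] := ih2 t.+1 _ _ (ltnW ht) w2 hrep1 a2.
  eexists; split.
  + rewrite !size_cat; apply: (run_cat r1); rewrite addnA; apply: (run_cat r2).
    by rewrite addnA; apply: (run_straight mem2 a3 isT).
  + by rewrite /= /upd eqxx v2 f2 ?v1 //; left.
  + have ht64 := wfe_lt w1.
    move=> j hj; rewrite /= /upd; have -> : (j == t) = false by lia.
    by rewrite f2 ?f1 //; lia.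
- move: hwf hat => /= /andP [w1 w2] /code_at_cat [a1 /code_at_cat [a2 a3]].
  have [mem1 [r1 v1 f1]] := ih1 _ _ _ ht w1 hrep a1.
  have hrep1 : represents B mem1 s.
    by apply: represents_temp hrep _ => j hj; apply: f1; lia.
  have [mem2 [r2 v2 f2]] := ih2 t.+1 _ _ (ltnW ht) w2 hrep1 a2.
  eexists; split.
  + rewrite !size_cat; apply: (run_cat r1); rewrite addnA; apply: (run_cat r2).
    by rewrite addnA; apply: (run_straight mem2 a3 isT).
  + by rewrite /= /upd eqxx v2 f2 ?v1 //; left.
  + have ht64 := wfe_lt w1.
    move=> j hj; rewrite /= /upd; have -> : (j == t) = false by lia.
    by rewrite f2 ?f1 //; lia.
- have /and3P [w1 w2 w3] := hwf.
  case: (code_at_cat (p2 := addr t a ++ _) hat) => a1 /code_at_cat [a2 a3].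
  have [mem1 [r1 v1 f1]] := ih _ _ _ ht w3 hrep a1.
  have [mem2 [r2 v2 f2]] := addr_correct mem1 (ltnW (ltnW (leq_trans (isT : 4 < 32) ht))) a2.
  eexists; split.
  + rewrite (_ : cexpr t _ = cexpr t e ++ addr t a ++ [:: ILoad t t]) // !size_cat.
    apply: (run_cat r1); rewrite addnA; apply: (run_cat r2).
    by rewrite addnA; apply: (run_straight mem2 a3 isT).
  + rewrite /= /upd eqxx v2 v1; case: hrep => hB h2 _ ha.
    rewrite f1; last by lia.
    by rewrite h2 f2 ?f1 ?ha //; lia.
  + move=> j hj; rewrite /= /upd; have -> : (j == t) = false by lia.
    by rewrite f2 ?f1 //; lia.
Qed.

Theorem ccmd_correct P B c s pc mem :
  wf c -> represents B mem s -> code_at P pc (ccmd pc c) ->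
  exists t mem', [/\ t <= cost c (env s),
    run P t (pc, mem) = Some (pc + size (ccmd pc c), mem') &
    represents B mem' (exec c s)].
Proof.
elim: c s pc mem => [x e|a e1 e2|c1 ih1 c2 ih2|e c ih|x y c ih] s pc mem hwf hrep hat.
- move: hwf hat => /= /andP [hx we] /code_at_cat [a1 a2].
  have [mem1 [r1 v1 f1]] := cexpr_correct (isT : 31 < 32) we hrep a1.
  exists (size (cexpr 32 e) + 2); eexists; split; first by [].
    rewrite size_cat addnA; apply: (run_cat r1); exact: (run_straight mem1 a2 isT).
  case/andP: (hx) => _ hx2; apply: represents_setv hx hrep _ _ => /=.
    rewrite /upd !eqxx; have -> : (32 == x) = false by lia.
    by rewrite add0n.
  by move=> j /negPf hj hj2; rewrite /upd !hj f1.
- have /and3P [ha w1 w2] := hwf.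
  case: (code_at_cat (p2 := addr 32 a ++ _) hat) => a1 /code_at_cat [a2 /code_at_cat [a3 a4]].
  have [mem1 [r1 v1 f1]] := cexpr_correct (isT : 31 < 32) w1 hrep a1.
  have [mem2 [r2 v2 f2]] := addr_correct mem1 (isT : 2 < 32) a2.
  have hrep2 : represents B mem2 s.
    by apply: represents_temp hrep _ => j hj; rewrite f2 ?f1 //; lia.
  have [mem3 [r3 v3 f3]] := cexpr_correct (isT : 31 < 33) w2 hrep2 a3.
  exists (size (cexpr 32 e1) + (6 + (size (cexpr 33 e2) + 1))); eexists; split; first by rewrite /=; lia.
    rewrite (_ : ccmd _ _ = cexpr 32 e1 ++ addr 32 a ++ cexpr 33 e2 ++ [:: IStore 32 33]) //.
    rewrite (run_cat r1 (run_cat r2 (run_cat r3 (run_straight mem3 a4 isT)))) !size_cat /=.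
    congr (Some (_, _)); lia.
  have h32 : mem3 32 = B + 8 * eval s e1 + a.
    by rewrite f3 ?v2 ?v1 ?f1; [case: hrep => _ -> | left | left].
  apply: represents_seta ha hrep _ _ => /=; first by rewrite /upd h32 eqxx v3.
  by move=> j hj1 hj2; rewrite /upd h32 (negPf hj1) f3 ?f2 ?f1 //; lia.
- move: hwf hat => /= /and3P [w1 w2 hd] /code_at_cat [a1 a2].
  have [t1 [mem1 [l1 r1 rep1]]] := ih1 _ _ _ w1 hrep a1.
  have [t2 [mem2 [l2 r2 rep2]]] := ih2 _ _ _ w2 rep1 a2.
  exists (t1 + t2), mem2; split=> //.
    by rewrite (cost_agree (exec_agree c1 s) hd) in l2; rewrite leq_add.
  by rewrite size_cat addnA; apply: run_cat r1 r2.
- move: hwf hat => /= /andP [w1 w2] /code_at_cat [a1 a2].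
  have [mem1 [r1 v1 f1]] := cexpr_correct (isT : 31 < 32) w1 hrep a1.
  have hrep1 := represents_temp hrep f1.
  have rj := run_jz mem1 a2; rewrite v1 in rj.
  case: ifP rj => he rj.
    exists (size (cexpr 32 e) + 1), mem1; split=> //; first by rewrite leq_addr.
    rewrite (run_cat r1 rj) size_cat /=; congr (Some (_, _)); lia.
  rewrite -cat1s in a2; case: (code_at_cat a2) => _ a3 {a2}.
  have [t2 [mem2 [l2 r2 rep2]]] := ih s (pc + size (cexpr 32 e) + 1) mem1 w2 hrep1 a3.
  exists (size (cexpr 32 e) + 1 + t2), mem2; split=> //; first by rewrite leq_add2l.
  rewrite -[(pc + _).+1]addn1 in rj; rewrite (run_cat (run_cat r1 rj) r2) size_cat /=.
  congr (Some (_, _)); lia.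
- move: hwf => /= /and5P [hx hy nx wc hd].
  pose p1 := ccmd (pc + 3) c; pose fin := pc + 3 + size p1 + 4.
  have {}hat : code_at P pc ([:: IConst x 0] ++ [:: ISub 32 y x] ++ [:: IJz 32 fin] ++
      p1 ++ [:: IConst 32 1; IAdd x x 32; IConst 32 0] ++ [:: IJz 32 (pc + 1)]) := hat.
  have [a0 /code_at_cat [b1 /code_at_cat [a2 /code_at_cat [a4 /code_at_cat [a5 a6]]]]]
    := code_at_cat hat.
  rewrite /= in b1 a2 a4 a5 a6.
  have ea : pc + 1 + 1 = pc + 2 by rewrite -addnA.
  have eb : pc + 2 + 1 = pc + 3 by rewrite -addnA.
  rewrite ea in a2; rewrite ea eb in a4 a5 a6.
  case/andP: (hx) => hx1 hx2; case/andP: (hy) => hy1 hy2.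
  have hxy : y != x.
    by apply: contraNneq hd => ->; rewrite /= inE eqxx.
  pose F i t := setv (exec c t) x i.+1.
  (* After [n] passes control is back at the test at [pc + 1]. The extra unit of time is the
     initialisation of the counter; the last test supplies the other two units of the 3 in
     [cost]. *)
  have inv n : n <= env s y -> exists t mem',
    let u := iteri n F (setv s x 0) in
    [/\ t <= n * (cost c (env s) + 6) + 1, run P t (pc, mem) = Some (pc + 1, mem'),
        represents B mem' u, env u x = n & agree (x :: assigned c) (updated c) s u].
    elim: n => [|n ihn] hn.
      exists 1; eexists; split=> //; first exact: (run_straight mem a0 isT).
      - apply: represents_setv hx hrep _ _ => /=; first by rewrite /upd eqxx.
        by move=> j /negPf hj _; rewrite /upd hj.
      - by rewrite /= /upd eqxx.
      - by apply: agree_setv; rewrite inE eqxx.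
    have [t [mem1 [l1 r1 rep1 ux ag]]] := ihn (ltnW hn).
    set u := iteri n F _ in rep1 ux ag.
    have uy : env u y = env s y.
      by case: ag => ag _; apply: ag; apply: contra hd => h; rewrite /= h.
    have r2 := run_straight mem1 b1 isT.
    set mem2 := foldl _ _ _ in r2.
    have e2 : mem2 32 = env s y - n.
      by case: rep1 => _ _ hv _; rewrite /mem2 /= /upd eqxx !hv // ux uy.
    have f2 j : j < 32 \/ 64 <= j -> mem2 j = mem1 j.
      by move=> hj; rewrite /mem2 /= /upd; case: eqP => // ?; lia.
    have rep2 := represents_temp rep1 f2.
    have h0 : (env s y - n == 0) = false by lia.
    have r3 : run P 1 (pc + 2, mem2) = Some (pc + 3, mem2).
      by rewrite (run_jz mem2 a2) e2 h0 -addnS.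
    have [t4 [mem4 [l4 r4 rep4]]] := ih u (pc + 3) mem2 wc rep2 a4.
    have r5 := run_straight mem4 a5 isT.
    set mem5 := foldl _ _ _ in r5.
    have r6 : run P 1 (pc + 3 + size p1 + 3, mem5) = Some (pc + 1, mem5).
      exact: run_jz mem5 a6.
    rewrite -addnA in r2.
    exists (t + (1 + (1 + (t4 + (3 + 1))))), mem5; split.
    + have -> : cost c (env s) = cost c (env u).
        apply/esym; apply: (cost_agree ag); apply: contra hd => /=.
        by rewrite inE => ->; rewrite orbT.
      rewrite (cost_agree ag) in l4; last first.
        by apply: contra hd => /= ->; rewrite orbT.
      move: l1 l4; rewrite (cost_agree ag); last first.
        by apply: contra hd => /= ->; rewrite orbT.
      lia.
    + apply: (run_cat r1); apply: (run_cat r2); rewrite addnA; apply: (run_cat r3).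
      by apply: (run_cat r4); apply: (run_cat r5).
    + rewrite /u /=; apply: (represents_setv hx rep4).
        rewrite /mem5 /= /upd /=.
        have -> : (x == 32) = false by lia.
        rewrite eqxx; case: rep4 => _ _ -> // _.
        by case: (exec_agree c u) => -> // _; rewrite ux addn1.
      move=> j /negPf hj hj2; rewrite /mem5 /= /upd hj.
      by have -> : (j == 32) = false by lia.
    + by rewrite /= /upd eqxx.
    + apply: (agree_trans ag); apply: (agree_trans (t := exec c u)).
        by apply: agree_sub (exec_agree c u) => // z hz; rewrite inE hz orbT.
      by apply: agree_setv; rewrite inE eqxx.
  have [t [mem1 [l1 r1 rep1 ux ag]]] := inv _ (leqnn _).
  set u := iteri _ F _ in rep1 ux ag.
  have uy : env u y = env s y.
    by case: ag => ag _; apply: ag; apply: contra hd => h; rewrite /= h.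
  have r2 := run_straight mem1 b1 isT.
  set mem2 := foldl _ _ _ in r2.
  have e2 : mem2 32 = 0.
    by case: rep1 => _ _ hv _; rewrite /mem2 /= /upd eqxx !hv // ux uy subnn.
  have f2 j : j < 32 \/ 64 <= j -> mem2 j = mem1 j.
    by move=> hj; rewrite /mem2 /= /upd; case: eqP => // ?; lia.
  have r3 : run P 1 (pc + 2, mem2) = Some (fin, mem2).
    by rewrite (run_jz mem2 a2) e2.
  rewrite -addnA in r2.
  exists (t + (1 + 1)), mem2; split; first by lia.
    rewrite (run_cat r1 (run_cat r2 r3)) /fin /p1 /= size_cat /=; congr (Some (_, _)); lia.
  exact: represents_temp rep1 f2.
Qed.

(* Moves the input, which initially occupies the registers, to array 0 with
   base address 64 * L, where L is the length of the input.  Only the registers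
   0..4 can be used as workspace, which is why their contents are moved first. *)
Definition prelude : program :=
  [:: IAdd 0 0 0; IAdd 0 0 0; IAdd 0 0 0; IAdd 0 0 0; IAdd 0 0 0; IAdd 0 0 0;
      IStore 0 1; IConst 1 8; IAdd 0 0 1; IStore 0 2; IAdd 0 0 1; IStore 0 3;
      IAdd 0 0 1; IStore 0 4; IAdd 0 0 1; IConst 3 32; ISub 2 0 3; IConst 3 5;
      ISub 4 2 3; IJz 4 27;
      ILoad 4 3; IStore 0 4; IConst 4 1; IAdd 3 3 4; IAdd 0 0 1; IConst 4 0;
      IJz 4 18].

(** 576 is 9 * 64: the copy loop takes nine instructions per cell and runs over the source addresses
    from 5 to [B - 1]. It goes on to [B] because register 0 has already turned the length into [B];
    the surplus cells hold 0. Sources lie below [B] and targets do not, so no source is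
    overwritten. *)
Lemma prelude_correct P input :
  0 < size input -> code_at P 0 prelude ->
  exists t mem s, [/\ t <= 576 * size input,
    run P t (init input) = Some (27, mem),
    represents (64 * size input) mem s &
    forall j, arr s 0 j = nth 0 input j].
Proof.
move=> hL hat; set B := 64 * size input.
have hB : 64 <= B by rewrite /B; lia.
have inB j : B <= j.+1 -> nth 0 input j = 0.
  by move=> hj; apply: nth_default; move: hj; rewrite /B; lia.
have [a0 /code_at_cat [a1 /code_at_cat [a2 /code_at_cat [a3 a4]]]] :=
  code_at_cat (p1 := take 18 prelude) (p2 := [:: ISub 4 2 3] ++ [:: IJz 4 27] ++
    [:: ILoad 4 3; IStore 0 4; IConst 4 1; IAdd 3 3 4; IAdd 0 0 1; IConst 4 0] ++
    [:: IJz 4 18]) hat.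
rewrite /= in a1 a2 a3 a4.
(* [copied k R m]: the registers 0..4 hold R, the first k input cells have been
   copied, and the source cells from 5 on are still intact. *)
pose copied k (R m : memory) :=
  [/\ forall j, j < 5 -> m j = R j,
      forall j, 5 <= j < B -> m j = nth 0 input j.-1,
      forall j, j < k -> m (B + 8 * j) = nth 0 input j &
      forall j, k <= j -> m (B + 8 * j) = 0].
pose eff := foldl (fun m i => effect i m).
(* Code on registers alone preserves [copied] when the same code is run on the register file [R], so
   the values of registers 0 to 4 are computed apart from the rest of the memory. *)
have regs code k R m :
    all (fun i => match i with IConst r _ => r < 5
                  | IAdd r a b | ISub r a b => [&& r < 5, a < 5 & b < 5]
                  | _ => false end) code ->
    copied k R m -> copied k (eff R code) (eff m code).
  have reg r v k' R' m' : r < 5 -> copied k' R' m' -> copied k' (upd R' r v) (upd m' r v).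
    move=> hr [c1 c2 c3 c4]; split=> j hj; rewrite /upd.
    - by case: eqP => // _; apply: c1.
    - by case: eqP => [?|_]; [lia | apply: c2].
    - by case: eqP => [?|_]; [lia | apply: c3].
    - by case: eqP => [?|_]; [lia | apply: c4].
  elim: code R m => //= i code ih R m /andP [hi hc] g; apply: ih => //.
  case: i hi => //= [r v hr|r a b /and3P [hr ha hb]|r a b /and3P [hr ha hb]].
  - exact: reg.
  - by case: (g) => c1 _ _ _; rewrite !c1 //; apply: reg.
  - by case: (g) => c1 _ _ _; rewrite !c1 //; apply: reg.
have store k R m : copied k R m -> forall r, r < 5 -> R 0 = B + 8 * k ->
    R r = nth 0 input k -> copied k.+1 R (effect (IStore 0 r) m).
  move=> [c1 c2 c3 c4] r hr h0 hv; rewrite /= (c1 0) // (c1 r) // h0 hv.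
  split=> j hj; rewrite /upd.
  - by case: eqP => [?|_]; [lia | apply: c1].
  - by case: eqP => [?|_]; [lia | apply: c2].
  - case: eqP => [?|ne]; first by congr (nth 0 input _); lia.
    by apply: c3; lia.
  - by case: eqP => [?|_]; [lia | apply: c4; lia].
(* Input entry [j] starts at address [j + 1]. The straight-line code has moved entries 0 to 3, so
   the pass numbered [i] from 0 copies entry [4 + i] from address [5 + i]. *)
have H i : i <= B - 5 -> exists R m,
    [/\ run P (18 + 9 * i) (init input) = Some (18, m), copied (4 + i) R m
      & [/\ R 0 = B + 8 * (4 + i), R 1 = 8, R 2 = B & R 3 = 5 + i]].
  elim: i => [|i ih] hi.
    pose m0 : memory := fun i => if i == 0 then size input else nth 0 input i.-1.
    have c0 : copied 0 m0 m0.
      split=> // j hj; first by rewrite /m0; case: eqP => //; lia.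
      by rewrite /m0; case: eqP => [|_]; [lia | apply: inB; lia].
    have [R1 [c1 [q0 q1 q2 q3 q4]]] : exists R1,
        copied 0 R1 (eff m0 (nseq 6 (IAdd 0 0 0))) /\
        [/\ R1 0 = B, R1 1 = nth 0 input 0, R1 2 = nth 0 input 1,
            R1 3 = nth 0 input 2 & R1 4 = nth 0 input 3].
      exists (eff m0 (nseq 6 (IAdd 0 0 0))); split; first exact: regs.
      by split=> //; rewrite /= /upd /= /m0 /= /B; lia.
    have c2 := store _ _ _ c1 1 isT ltac:(rewrite q0; lia) q1.
    have c3 := regs [:: IConst 1 8; IAdd 0 0 1] _ _ _ isT c2.
    have c4 := store _ _ _ c3 2 isT ltac:(rewrite /= /upd /= q0; lia) q2.
    have c5 := regs [:: IAdd 0 0 1] _ _ _ isT c4.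
    have c6 := store _ _ _ c5 3 isT ltac:(rewrite /= /upd /= q0; lia) q3.
    have c7 := regs [:: IAdd 0 0 1] _ _ _ isT c6.
    have c8 := store _ _ _ c7 4 isT ltac:(rewrite /= /upd /= q0; lia) q4.
    have c9 := regs [:: IAdd 0 0 1; IConst 3 32; ISub 2 0 3; IConst 3 5] _ _ _ isT c8.
    have r0 := run_straight m0 a0 isT.
    eexists _, _; split; first exact: r0.
      exact: c9.
    by split; rewrite /= /upd /= ?q0; lia.
  have {}[R [m [r1 c [R0 R1 R2 R3]]]] := ih (ltnW hi).
  have r2 := run_straight m a1 isT; rewrite -/eff in r2.
  have c2 := regs [:: ISub 4 2 3] _ _ _ isT c.
  set R' := eff R _ in c2; set m' := eff m _ in r2 c2.
  have r3 : run P 1 (19, m') = Some (20, m').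
    rewrite (run_jz m' a2); case: c2 => -> // _ _ _.
    have -> : R' 4 = B - (5 + i) by rewrite /R' /= /upd /= R2 R3.
    by have -> : (B - (5 + i) == 0) = false by lia.
  have r4 := run_straight m' a3 isT; rewrite -/eff in r4.
  set m'' := eff m' _ in r4.
  have r5 := run_jz m'' a4.
  have c3 : copied (4 + i) (upd R' 4 (nth 0 input (4 + i))) (effect (ILoad 4 3) m').
    case: c2 => d1 d2 d3 d4; split=> j hj; rewrite /= /upd.
    - case: eqP => [_|_]; last exact: d1.
      have -> : m' 3 = 5 + i by rewrite d1.
      by rewrite d2 //; lia.
    - by case: eqP => [?|_]; [lia | apply: d2].
    - by case: eqP => [?|_]; [lia | apply: d3].
    - by case: eqP => [?|_]; [lia | apply: d4].
  have c4 := store _ _ _ c3 4 isT ltac:(rewrite /R' /= /upd /= R0; lia) erefl.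
  have c5 := regs [:: IConst 4 1; IAdd 3 3 4; IAdd 0 0 1; IConst 4 0] _ _ _ isT c4.
  exists (eff (upd R' 4 (nth 0 input (4 + i)))
    [:: IConst 4 1; IAdd 3 3 4; IAdd 0 0 1; IConst 4 0]), m''; split; last 1 first.
  - split; rewrite /R' /= /upd /= ?R0 ?R1 ?R2 ?R3; lia.
  - have -> : 18 + 9 * i.+1 = 18 + 9 * i + (1 + (1 + (6 + 1))) by lia.
    apply: (run_cat r1); apply: (run_cat r2); apply: (run_cat r3); apply: (run_cat r4).
    by rewrite r5.
  - by rewrite addnS; exact: c5.
have [R [m [r1 c [R0 R1 R2 R3]]]] := H _ (leqnn _).
have r2 := run_straight m a1 isT; rewrite -/eff in r2.
have c2 := regs [:: ISub 4 2 3] _ _ _ isT c.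
set R' := eff R _ in c2; set m' := eff m _ in r2 c2.
have r3 : run P 1 (19, m') = Some (27, m').
  rewrite (run_jz m' a2); case: c2 => -> // _ _ _.
  have -> : R' 4 = B - (5 + (B - 5)) by rewrite /R' /= /upd /= R2 R3.
  by have -> : B - (5 + (B - 5)) = 0 by lia.
(* The state is read off the memory. Only array 0 is promised to have known contents, so programs
   initialise everything else that they read. *)
exists (18 + 9 * (B - 5) + (1 + 1)), m', (State m' (fun a i => m' (B + 8 * i + a))).
case: c2 => d1 d2 d3 d4; split.
- by rewrite /B in hB *; lia.
- by apply: (run_cat r1); apply: run_cat r2 r3.
- by split=> //; rewrite d1.
- move=> j; rewrite /= addn0; case: (ltnP j (4 + (B - 5))) => hj; first exact: d3.
  by rewrite d4 // inB //; lia.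
Qed.

(** Lists are used because [wf] forbids a command to compute the bounds of its own loops. In a list,
    each cost is taken in the state that the earlier commands have reached, so they may compute
    these bounds. *)
Fixpoint ccmds (pc : nat) (cs : seq cmd) : program :=
  if cs is c :: cs' then let p := ccmd pc c in p ++ ccmds (pc + size p) cs' else [::].

Fixpoint costs (cs : seq cmd) (s : state) : nat :=
  if cs is c :: cs' then cost c (env s) + costs cs' (exec c s) else 0.

Definition execs (cs : seq cmd) (s : state) : state := foldl (fun t c => exec c t) s cs.

Lemma ccmds_correct P B cs s pc mem :
  all wf cs -> represents B mem s -> code_at P pc (ccmds pc cs) ->
  exists t mem', [/\ t <= costs cs s,
    run P t (pc, mem) = Some (pc + size (ccmds pc cs), mem') &
    represents B mem' (execs cs s)].
Proof.
elim: cs s pc mem => [|c cs ih] s pc mem /=.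
  by move=> _ rep _; exists 0, mem; split=> //; rewrite /= addn0.
case/andP=> wc wcs rep /code_at_cat [a1 a2].
have [t1 [mem1 [l1 r1 rep1]]] := ccmd_correct wc rep a1.
have [t2 [mem2 [l2 r2 rep2]]] := ih _ _ _ wcs rep1 a2.
exists (t1 + t2), mem2; split=> //; first exact: leq_add.
by rewrite size_cat addnA; apply: run_cat r1 r2.
Qed.

Definition compile (cs : seq cmd) (out : nat) : program :=
  prelude ++ ccmds 27 cs ++ [:: IHalt out].

Theorem compile_correct cs out input :
  all wf cs -> isvar out -> 0 < size input ->
  exists t s, [/\ forall j, arr s 0 j = nth 0 input j,
    t <= 576 * size input + costs cs s &
    halts_with (compile cs out) input t (env (execs cs s) out)].
Proof.
move=> wcs hout hL.
have hat : code_at (compile cs out) 0 (compile cs out).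
  by exists [::], [::]; rewrite /= cats0.
have [a1 /code_at_cat [a2 a3]] := code_at_cat hat.
have [t1 [mem1 [s [l1 r1 rep1 harr]]]] := prelude_correct hL a1.
have [t2 [mem2 [l2 r2 rep2]]] := ccmds_correct wcs rep1 a2.
exists (t1 + t2), s; split=> //; first exact: leq_add.
exists (27 + size (ccmds 27 cs), mem2); split; first exact: run_cat r1 r2.
have := code_at_fetch a3; rewrite /halt_output => ->.
by case: rep2 => _ _ -> //.
Qed.

(** * The brute-force search *)

Notation "c1 ;; c2" := (Seq c1 c2) (at level 69, right associativity).

Notation "$ x" := (EVar x) (at level 0, x at level 0, format "$ x").

(** Under truncated subtraction one summand is always 0; the sum is the distance of the two values
    and serves as a test for inequality. *)
Definition diff (e1 e2 : expr) : expr := EAdd (ESub e1 e2) (ESub e2 e1).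

(** The RAM has no multiplication, so row offsets are found by repeated addition. *)
Definition addmul (q v y : nat) : cmd := For 12 y (Assign q (EAdd ($ q) ($ v))).

(* Registers: 3 = m, 4 = n, 5 = p, 6 = k, 7 = address of the bundling matrix,
   8 = number of subsets to enumerate, 9 = answer, 10 = v, 11 = u, 12 = i.
   Arrays: 0 = input, 1 = binary weight of a representative voter (0 for the
   other voters), 2 = the current subset, 3 = the voters it deletes. *)

Definition setup : cmd :=
  Assign 3 (EGet 0 (ENum 0));; Assign 4 (EGet 0 (ENum 1));;
  Assign 5 (EGet 0 (ENum 2));; Assign 6 (EGet 0 (ENum 3));;
  Assign 9 (ENum 0).

Definition compare_rows : cmd :=
  Assign 15 (ENum 1);;
  For 12 4 (If (diff (EGet 0 (EAdd ($13) ($12))) (EGet 0 (EAdd ($14) ($12))))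
              (Assign 15 (ENum 0))).

Definition find_duplicate : cmd :=
  Assign 13 ($7);; addmul 13 10 4;; Assign 16 (ENum 0);;
  For 11 4 (If (ESub ($10) ($11))
    (Assign 14 ($7);; addmul 14 11 4;; compare_rows;; If ($15) (Assign 16 (ENum 1)))).

(** Register 8 doubles at each representative: it is the weight of the next one and, at the end, the
    number of subsets. *)
Definition representatives : cmd :=
  Assign 7 (ENum 4);; addmul 7 3 4;; Assign 8 (ENum 1);;
  For 10 4 (
    find_duplicate;; Put 1 ($10) (ENum 0);; Put 2 ($10) (ENum 0);;
    If (ESub (ENum 1) ($16)) (Put 1 ($10) ($8);; Assign 8 (EAdd ($8) ($8)))).

Definition subset_size : cmd :=
  Assign 18 (ENum 0);; For 10 4 (Assign 18 (EAdd ($18) (EGet 2 ($10)))).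

Definition mark_deleted : cmd :=
  For 11 4 (Put 3 ($11) (ENum 0);;
    For 10 4 (If (EGet 2 ($10))
      (Assign 13 ($7);; addmul 13 10 4;;
       If (EGet 0 (EAdd ($13) ($11))) (Put 3 ($11) (ENum 1))))).

Definition locate : cmd :=
  Assign 13 (ENum 4);; addmul 13 11 3;; Assign 22 (ENum 0);; Assign 23 (ENum 0);;
  For 12 3 (
    If (ESub (ENum 1) (diff (EGet 0 (EAdd ($13) ($12))) ($5))) (Assign 22 ($12));;
    If (ESub (ENum 1) (diff (EGet 0 (EAdd ($13) ($12))) ($19))) (Assign 23 ($12))).

Definition supports_expr (R : voting_rule) (x y : nat) : expr :=
  match R with
  | Plurality => ESub (ENum 1) ($x)
  | Condorcet => ESub ($y) ($x)
  end.

Definition tally_votes (R : voting_rule) : cmd :=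
  Assign 20 (ENum 0);; Assign 21 (ENum 0);;
  For 11 4 (If (ESub (ENum 1) (EGet 3 ($11)))
    (locate;;
     If (supports_expr R 22 23) (Assign 20 (EAdd ($20) (ENum 1)));;
     If (supports_expr R 23 22) (Assign 21 (EAdd ($21) (ENum 1))))).

(** Under Plurality, p never has a larger score than itself, so every candidate may be tried. Under
    Condorcet a tie already defeats p, and p ties with itself, so p must be skipped. *)
Definition rival_expr (R : voting_rule) : expr :=
  match R with Plurality => ENum 1 | Condorcet => diff ($19) ($5) end.

Definition beaten_expr (R : voting_rule) : expr :=
  match R with
  | Plurality => ESub ($21) ($20)
  | Condorcet => ESub (EAdd ($21) (ENum 1)) ($20)
  end.

Definition test_subset (R : voting_rule) : cmd :=
  subset_size;; mark_deleted;;
  For 19 3 (tally_votes R;;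
    If (rival_expr R) (If (beaten_expr R)
      (If (ESub (EAdd ($6) (ENum 1)) ($18)) (Assign 9 (ENum 1))))).

(** Binary increment with the carry in register 24; the digits are the voters of nonzero weight,
    lowest first. *)
Definition next_subset : cmd :=
  Assign 24 (ENum 1);;
  For 10 4 (If (EGet 1 ($10)) (If ($24)
    (Assign 24 (EGet 2 ($10));; Put 2 ($10) (ESub (ENum 1) (EGet 2 ($10)))))).

Definition search (R : voting_rule) : cmd :=
  For 17 8 (test_subset R;; next_subset).

Definition solver (R : voting_rule) : seq cmd :=
  [:: setup; representatives; search R].

Lemma wf_solver R : all wf (solver R).
Proof. by case: R. Qed.

(** * The search as functions of the raw input *)

Definition bundled (x : nat -> nat) (m n v u : nat) : nat := x (4 + n * m + n * v + u).

Definition same_row (x : nat -> nat) (m n u v : nat) : bool :=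
  all (fun i => bundled x m n u i == bundled x m n v i) (iota 0 n).

Definition is_rep (x : nat -> nat) (m n v : nat) : bool :=
  ~~ has (fun u => (u < v) && same_row x m n u v) (iota 0 n).

Definition rank (x : nat -> nat) (m n v : nat) : nat :=
  count (is_rep x m n) (iota 0 v).

Definition weight (x : nat -> nat) (m n v : nat) : nat :=
  if is_rep x m n v then 2 ^ rank x m n v else 0.

Definition deleted (x : nat -> nat) (m n : nat) (b : seq nat) (u : nat) : bool :=
  has (fun v => (nth 0 b v != 0) && (bundled x m n v u != 0)) (iota 0 n).

(** This takes the last match, and 0 by default; a preference order has exactly one match. *)
Definition position (x : nat -> nat) (m u c : nat) : nat :=
  foldl (fun a i => if x (4 + m * u + i) == c then i else a) 0 (iota 0 m).

Definition supports (R : voting_rule) (i j : nat) : bool :=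
  match R with Plurality => i == 0 | Condorcet => i < j end.

Definition tally (R : voting_rule) (x : nat -> nat) (m n : nat) (b : seq nat)
    (c d : nat) : nat :=
  count (fun u => ~~ deleted x m n b u &&
    supports R (position x m u c) (position x m u d)) (iota 0 n).

(** The negation of one instance of the winning condition, so that p fails to win exactly when some
    candidate defeats it. *)
Definition defeats (R : voting_rule) (x : nat -> nat) (m n p : nat) (b : seq nat)
    (c : nat) : bool :=
  match R with
  | Plurality => tally R x m n b p c < tally R x m n b c p
  | Condorcet => (c != p) && (tally R x m n b p c <= tally R x m n b c p)
  end.

Definition success (R : voting_rule) (x : nat -> nat) (m n p k : nat) (b : seq nat) : bool :=
  (sumn b <= k) && has (defeats R x m n p b) (iota 0 m).

(** The data that stay constant once register 7 is set. *)
Definition params (x : nat -> nat) (m n p k : nat) (s : state) : Prop :=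
  [/\ [/\ env s 3 = m, env s 4 = n, env s 5 = p, env s 6 = k & env s 7 = 4 + n * m]
    & forall j, arr s 0 j = x j].

Lemma params_agree x m n p k xs as_ s t :
  agree xs as_ s t -> ~~ has (mem [:: 3; 4; 5; 6; 7]) xs -> 0 \notin as_ ->
  params x m n p k s -> params x m n p k t.
Proof.
move=> [he ha] /hasPn hx h0 [[h3 h4 h5 h6 h7] hj].
have nx z : z \in [:: 3; 4; 5; 6; 7] -> z \notin xs.
  by move=> hz; apply/negP => /hx; rewrite /= hz.
by split; [split; rewrite he ?nx | move=> j; rewrite ha].
Qed.

(** * Correctness of the loops, up to the test of one subset *)

Lemma iota_rcons i : iota 0 i.+1 = rcons (iota 0 i) i.
Proof. by rewrite -addn1 iotaD cats1. Qed.

Lemma addmul_correct q v y s :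
  q != 12 -> v != 12 -> v != q ->
  env (exec (addmul q v y) s) q = env s q + env s y * env s v.
Proof.
move=> hq hv hvq.
apply: (for_rule (Inv := fun i t => env t q = env s q + i * env s v)).
  by rewrite /= /upd (negPf hq) mul0n addn0.
move=> i t _ ti [ag _] it /=; rewrite /upd (negPf hq) eqxx it mulSn.
by rewrite (ag v) ?inE ?(negPf hv) ?(negPf hvq) // addnAC addnA.
Qed.

Lemma diff_eq0 s e1 e2 : (eval s (diff e1 e2) == 0) = (eval s e1 == eval s e2).
Proof. by rewrite /=; lia. Qed.

Lemma exec_seq c1 c2 s : exec (c1;; c2) s = exec c2 (exec c1 s).
Proof. by []. Qed.

Lemma exec_if e c s : exec (If e c) s = if eval s e == 0 then s else exec c s.
Proof. by []. Qed.

Lemma exec_assign z e s : exec (Assign z e) s = setv s z (eval s e).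
Proof. by []. Qed.

Lemma exec_put a e1 e2 s : exec (Put a e1 e2) s = seta s a (eval s e1) (eval s e2).
Proof. by []. Qed.

Lemma compare_rows_correct x m n p k s :
  params x m n p k s ->
  env (exec compare_rows s) 15 =
  all (fun i => x (env s 13 + i) == x (env s 14 + i)) (iota 0 n).
Proof.
(* [for_rule] concludes at the loop bound as a value of the environment, so [n] is first put into
   that form; the later loop proofs do the same. *)
move=> [[_ h4 _ _ _] hx]; rewrite -h4.
rewrite /compare_rows exec_seq.
apply: (for_rule (Inv := fun i t => env t 15 =
  all (fun i => x (env s 13 + i) == x (env s 14 + i)) (iota 0 i))) => //.
move=> i t _ ti [ag aa] it.
rewrite iota_rcons all_rcons exec_if diff_eq0 /= !aa // !hx ti !ag //.
by case: eqP => _; rewrite /= /upd /= ?it.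
Qed.

Lemma find_duplicate_correct x m n p k s :
  params x m n p k s ->
  env (exec find_duplicate s) 16 =
  has (fun u => (u < env s 10) && same_row x m n u (env s 10)) (iota 0 n).
Proof.
move=> hp; case: (hp) => [[h3 h4 h5 h6 h7] _].
rewrite /find_duplicate !exec_seq.
set s1 := exec (addmul _ _ _) _; set s2 := exec (Assign 16 _) s1.
have q1 : env s1 13 = 4 + n * m + n * env s 10.
  by rewrite /s1 addmul_correct //= /upd /= h4 h7.
have ag2 : agree _ _ s s2 :=
  exec_agree (Assign 13 ($7);; addmul 13 10 4;; Assign 16 (ENum 0)) s.
have hp2 := params_agree ag2 isT isT hp.
have n2 : env s2 4 = n by case: hp2 => [[]].
rewrite -{}n2.
apply: (for_rule (Inv := fun i t => env t 16 =
  has (fun u => (u < env s 10) && same_row x m (env s2 4) u (env s 10)) (iota 0 i))) => //.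
move=> i t _ ti ag it.
have hpt := params_agree ag isT isT hp2.
have tq : env t 13 = 4 + n * m + n * env s 10 by case: ag => -> // _; rewrite -q1.
have tv : env t 10 = env s 10 by case: ag => -> // _; case: ag2 => ->.
rewrite iota_rcons has_rcons exec_if [eval _ _]/= ti tv subn_eq0.
case: leqP => [_|hi]; first by rewrite /= /upd /= it.
rewrite !exec_seq exec_if.
set t3 := exec (addmul _ _ _) _; set t4 := exec compare_rows t3.
have ag3 : agree _ _ t t3 := exec_agree (Assign 14 ($7);; addmul 14 11 4) t.
have hp3 := params_agree ag3 isT isT hpt.
have q3 : env t3 14 = 4 + n * m + n * i.
  by case: hpt => [[_ g4 _ _ g7] _]; rewrite /t3 addmul_correct //= /upd /= g4 g7 ti.
have q4 : env t3 13 = 4 + n * m + n * env s 10 by case: ag3 => ->.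
have n2 : env s2 4 = n by case: hp2 => [[]].
have e4 : env t4 15 = same_row x m n i (env s 10).
  rewrite /t4 (compare_rows_correct hp3) q3 q4; congr nat_of_bool.
  by apply: eq_all => j; rewrite eq_sym.
have d4 : env t4 16 = env t 16.
  by case: (exec_agree compare_rows t3) => -> // _; case: ag3 => ->.
rewrite [eval _ _]/= e4 n2; case: same_row => /=; rewrite /upd /= ?d4 ?it ?n2 //.
Qed.

Lemma rankS x m n v : rank x m n v.+1 = is_rep x m n v + rank x m n v.
Proof. by rewrite /rank iota_rcons -cats1 count_cat /= addn0 addnC. Qed.

Lemma representatives_correct x m n p k s :
  [/\ env s 3 = m, env s 4 = n, env s 5 = p & env s 6 = k] ->
  (forall j, arr s 0 j = x j) ->
  let t := exec representatives s in
  [/\ params x m n p k t, env t 8 = 2 ^ rank x m n n &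
      forall v, v < n -> arr t 1 v = weight x m n v /\ arr t 2 v = 0].
Proof.
move=> [h3 h4 h5 h6] hx; rewrite /representatives !exec_seq.
set s1 := exec (addmul _ _ _) _; set s2 := exec (Assign 8 _) s1.
have ag2 : agree _ _ s s2 :=
  exec_agree (Assign 7 (ENum 4);; addmul 7 3 4;; Assign 8 (ENum 1)) s.
have hp2 : params x m n p k s2.
  case: (ag2) => he ha; split=> [|j]; last by rewrite ha.
  split; [by rewrite he|by rewrite he|by rewrite he|by rewrite he|].
  by rewrite (_ : env s2 7 = env s1 7) // /s1 addmul_correct //= /upd /= h3 h4 mulnC.
have n2 : env s2 4 = n by case: hp2 => [[]].
set body := (X in For 10 4 X); set t := exec (For 10 4 body) s2.
have hpt : params x m n p k t.
  exact: (params_agree (exec_agree (For 10 4 body) s2) isT isT hp2).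
suff : env t 8 = 2 ^ rank x m n (env s2 4) /\
    forall v, v < env s2 4 -> arr t 1 v = weight x m n v /\ arr t 2 v = 0.
  by rewrite n2 => -[].
apply: (for_rule (Inv := fun i t => env t 8 = 2 ^ rank x m n i /\
    forall v, v < i -> arr t 1 v = weight x m n v /\ arr t 2 v = 0)); first by split.
move=> i {hpt}t hi ti ag [c8 c12].
have hpt := params_agree ag isT isT hp2.
rewrite /body 3!exec_seq exec_if !exec_put.
set t1 := exec find_duplicate t; set t2 := seta (seta t1 1 _ _) 2 _ _.
have ag1 : agree _ _ t t1 := exec_agree find_duplicate t.
have d1 : env t1 16 = ~~ is_rep x m n i.
  by rewrite /t1 (find_duplicate_correct hpt) ti negbK.
have e10 : env t1 10 = i by case: ag1 => ->.
have e8 : env t1 8 = 2 ^ rank x m n i by case: ag1 => ->.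
have a1 : arr t1 1 = arr t 1 by case: ag1 => _ ->.
have a2 : arr t1 2 = arr t 2 by case: ag1 => _ ->.
rewrite [eval _ _]/= d1 rankS /weight.
case hr: (is_rep x m n i); rewrite /=; rewrite /upd /=.
- split; first by rewrite e8 expnS mul2n addnn.
  move=> v; rewrite ltnS leq_eqVlt e10 e8 a1 a2 => /orP [/eqP ->|hv].
    by rewrite eqxx hr.
  by rewrite (ltn_eqF hv); apply: c12.
- split; first by rewrite e8.
  move=> v; rewrite ltnS leq_eqVlt e10 a1 a2 => /orP [/eqP ->|hv].
    by rewrite eqxx hr.
  by rewrite (ltn_eqF hv); apply: c12.
Qed.

Lemma subset_size_correct n s :
  env s 4 = n -> env (exec subset_size s) 18 = sumn (mkseq (arr s 2) n).
Proof.
move=> <-; rewrite /subset_size exec_seq.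
apply: (for_rule (Inv := fun i t => env t 18 = sumn (mkseq (arr s 2) i))) => //.
move=> i t _ ti ag it; rewrite /mkseq iota_rcons map_rcons sumn_rcons /= /upd /= it.
by case: ag => _ ->; rewrite ?ti.
Qed.

Lemma mark_deleted_correct x m n p k s :
  params x m n p k s ->
  forall u, u < n ->
    arr (exec mark_deleted s) 3 u = deleted x m n (mkseq (arr s 2) n) u.
Proof.
move=> hp; case: (hp) => [[h3 h4 h5 h6 h7] _].
suff : forall u, u < env s 4 ->
    arr (exec mark_deleted s) 3 u = deleted x m n (mkseq (arr s 2) n) u by rewrite h4.
apply: (for_rule (Inv := fun i t => forall u, u < i ->
    arr t 3 u = deleted x m n (mkseq (arr s 2) n) u)) => //.
move=> i t hi ti ag it; rewrite exec_seq exec_put [eval _ _]/= ti.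
have hpt := params_agree ag isT isT hp.
set t1 := seta t 3 i 0; set fl := For _ _ _; set t2 := exec fl t1.
have hp1 : params x m n p k t1 by case: hpt => -[*]; split.
have n1 : env t1 4 = n by case: hp1 => [[]].
suff h : (forall u, u < i -> arr t2 3 u = arr t 3 u) /\
    arr t2 3 i = has (fun v => (nth 0 (mkseq (arr s 2) n) v != 0) &&
                               (bundled x m n v i != 0)) (iota 0 (env t1 4)).
  move=> u; rewrite ltnS leq_eqVlt => /orP [/eqP ->|hu] /=.
    by case: h => _ ->; rewrite n1.
  by case: h => h _; rewrite h //; apply: it.
(* The inner loop writes cell [i] only; the first conjunct keeps the marks already computed for
   smaller voters. *)
apply: (for_rule (Inv := fun j t' => (forall u, u < i -> arr t' 3 u = arr t 3 u) /\
    arr t' 3 i = has (fun v => (nth 0 (mkseq (arr s 2) n) v != 0) &&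
                               (bundled x m n v i != 0)) (iota 0 j))).
  by split=> [u hu|] /=; rewrite /upd ?eqxx // (ltn_eqF hu).
move=> j t' hj tj ag' [i1 i2].
have hp' := params_agree ag' isT isT hp1.
have ti' : env t' 11 = i by case: ag' => ->.
have a2 : arr t' 2 = arr s 2.
  by case: ag' => _ -> //; rewrite /t1 /=; case: ag => _ ->.
rewrite iota_rcons has_rcons nth_mkseq -?n1 // n1 exec_if [eval _ _]/= tj a2.
case: eqP => [_|_]; first by split.
rewrite 2!exec_seq exec_if.
set t3 := exec (addmul _ _ _) _.
have ag3 : agree _ _ t' t3 := exec_agree (Assign 13 ($7);; addmul 13 10 4) t'.
have hp3 := params_agree ag3 isT isT hp'.
have q3 : env t3 13 = 4 + n * m + n * j.
  by case: hp' => [[_ g4 _ _ g7] _]; rewrite /t3 addmul_correct //= /upd /= g4 g7 tj.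
have a3 : arr t3 3 = arr t' 3 by case: ag3 => _ ->.
have u3 : env t3 11 = i by case: ag3 => ->.
have -> : eval t3 (EGet 0 (EAdd $13 $11)) = bundled x m n j i.
  by case: hp3 => _ hx; rewrite /= hx q3 u3.
case: eqP => _; rewrite /= ?a3; first by split.
by split=> [u hu|]; rewrite u3 /upd ?eqxx // (ltn_eqF hu) i1.
Qed.

Lemma locate_correct x m n p k s :
  params x m n p k s ->
  env (exec locate s) 22 = position x m (env s 11) p /\
  env (exec locate s) 23 = position x m (env s 11) (env s 19).
Proof.
move=> hp; case: (hp) => [[h3 h4 h5 h6 h7] hx].
rewrite /locate 4!exec_seq.
set s1 := exec (addmul _ _ _) _; set s2 := exec (Assign 23 _) _.
have ag2 : agree _ _ s s2 := exec_agree (Assign 13 (ENum 4);; addmul 13 11 3;;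
  Assign 22 (ENum 0);; Assign 23 (ENum 0)) s.
have hp2 := params_agree ag2 isT isT hp.
have q2 : env s2 13 = 4 + m * env s 11.
  by rewrite (_ : env s2 13 = env s1 13) // /s1 addmul_correct //= /upd /= h3.
have e19 : env s2 19 = env s 19 by case: ag2 => ->.
rewrite /position.
have m2 : env s2 3 = m by case: hp2 => [[]].
set t0 := exec _ s2.
suff : env t0 22 = foldl (fun a i => if x (4 + m * env s 11 + i) == p then i else a) 0
                     (iota 0 (env s2 3)) /\
       env t0 23 = foldl (fun a i => if x (4 + m * env s 11 + i) == env s 19 then i else a) 0
                     (iota 0 (env s2 3)).
  by rewrite m2.
apply: (for_rule (Inv := fun j t =>
  env t 22 = foldl (fun a i => if x (4 + m * env s 11 + i) == p then i else a) 0 (iota 0 j) /\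
  env t 23 = foldl (fun a i => if x (4 + m * env s 11 + i) == env s 19 then i else a) 0
               (iota 0 j))) => //.
move=> i t _ ti ag [i1 i2].
have hpt := params_agree ag isT isT hp2.
have tq : env t 13 = 4 + m * env s 11 by case: ag => ->.
have t19 : env t 19 = env s 19 by case: ag => ->.
case: hpt => [[_ _ t5 _ _] tx].
rewrite iota_rcons !foldl_rcons exec_seq.
set t1 := exec _ t.
have tst e : (eval t (ESub (ENum 1) (diff (EGet 0 (EAdd $13 $12)) e)) == 0)
    = (x (4 + m * env s 11 + i) != eval t e).
  by rewrite [in LHS]/= tx tq ti; lia.
have e1 : env t1 22 = (if x (4 + m * env s 11 + i) == p then i else env t 22).
  by rewrite /t1 exec_if tst [eval _ _]/= t5; case: eqP => //= _; rewrite /upd /= ti.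
have e2 z : z != 22 -> env t1 z = env t z.
  by move=> hz; rewrite /t1 exec_if; case: ifP => // _; rewrite /= /upd (negPf hz).
have e3 : arr t1 = arr t by rewrite /t1 exec_if; case: ifP.
rewrite exec_if.
have -> : eval t1 (ESub (ENum 1) (diff (EGet 0 (EAdd $13 $12)) $19)) =
          eval t (ESub (ENum 1) (diff (EGet 0 (EAdd $13 $12)) $19)).
  by rewrite /= e3 !e2.
rewrite tst [eval _ _]/= t19 -i1 -i2 -e1.
case: eqP => _; rewrite /= /upd /=; split=> //; first by rewrite e2.
by rewrite e2.
Qed.

Lemma supports_eval R s y z :
  (eval s (supports_expr R y z) == 0) = ~~ supports R (env s y) (env s z).
Proof. by case: R => /=; lia. Qed.

Lemma tally_votes_correct R x m n p k b s :
  params x m n p k s ->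
  (forall u, u < n -> arr s 3 u = deleted x m n b u) ->
  env (exec (tally_votes R) s) 20 = tally R x m n b p (env s 19) /\
  env (exec (tally_votes R) s) 21 = tally R x m n b (env s 19) p.
Proof.
move=> hp hd; rewrite /tally_votes !exec_seq.
set s2 := exec (Assign 21 _) _.
have ag2 : agree _ _ s s2 := exec_agree (Assign 20 (ENum 0);; Assign 21 (ENum 0)) s.
have hp2 := params_agree ag2 isT isT hp.
have n2 : env s2 4 = n by case: hp2 => [[]].
set t0 := exec _ s2.
pose P c d u := ~~ deleted x m n b u && supports R (position x m u c) (position x m u d).
suff : env t0 20 = count (P p (env s 19)) (iota 0 (env s2 4)) /\
       env t0 21 = count (P (env s 19) p) (iota 0 (env s2 4)) by rewrite n2.
apply: (for_rule (Inv := fun j t => env t 20 = count (P p (env s 19)) (iota 0 j) /\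
  env t 21 = count (P (env s 19) p) (iota 0 j))) => //.
move=> i t hi ti ag [i1 i2]; rewrite n2 in hi.
have hpt := params_agree ag isT isT hp2.
have d3 : arr t 3 i = deleted x m n b i by case: ag => _ -> //; exact: hd.
have t19 : env t 19 = env s 19 by case: ag => ->.
rewrite iota_rcons -!cats1 !count_cat exec_if [eval _ _]/= ti d3.
rewrite [count _ [:: i]]/= [count (P (env s 19) p) [:: i]]/= !addn0 /P.
case: deleted => /=; first by rewrite /upd /= !addn0.
rewrite -/(exec locate t); set t1 := exec locate t.
have ag1 : agree _ _ t t1 := exec_agree locate t.
have [] := locate_correct hpt; rewrite -/t1 ti t19 => p1 p2.
have c1 : env t1 20 = env t 20 by case: ag1 => ->.
have c2 : env t1 21 = env t 21 by case: ag1 => ->.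
rewrite !supports_eval.
set t2 := (if ~~ supports R (env t1 22) _ then _ else _).
have e2 z : z != 20 -> env t2 z = env t1 z.
  by move=> hz; rewrite /t2; case: ifP => // _; rewrite /= /upd (negPf hz).
have e20 : env t2 20 = env t 20 + supports R (position x m i p) (position x m i (env s 19)).
  by rewrite /t2 p1 p2; case: supports; rewrite /= /upd /= c1 ?addn0.
rewrite !e2 // p1 p2.
by case: (supports R (position x m i (env s 19)) _);
  rewrite /= /upd /= e20 ?e2 // c2 i1 i2 ?addn0.
Qed.

Lemma test_subset_correct R x m n p k s :
  params x m n p k s ->
  env (exec (test_subset R) s) 9 =
  if success R x m n p k (mkseq (arr s 2) n) then 1 else env s 9.
Proof.
move=> hp; case: (hp) => [[h3 h4 h5 h6 h7] _]; rewrite /test_subset 2!exec_seq.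
set s1 := exec subset_size s; set s2 := exec mark_deleted s1.
have ag1 : agree _ _ s s1 := exec_agree subset_size s.
have ag2 : agree _ _ s1 s2 := exec_agree mark_deleted s1.
have hp1 := params_agree ag1 isT isT hp.
have hp2 := params_agree ag2 isT isT hp1.
set b := mkseq _ _.
have sz : env s2 18 = sumn b by case: ag2 => -> // _; exact: subset_size_correct.
have hd u : u < n -> arr s2 3 u = deleted x m n b u.
  have a1 : arr s1 2 = arr s 2 by case: ag1 => _ ->.
  by move=> hu; rewrite /s2 (mark_deleted_correct hp1 hu) a1.
have o2 : env s2 9 = env s 9 by case: ag2 => -> // _; case: ag1 => ->.
have m2 : env s2 3 = m by case: hp2 => [[]].
rewrite /success -m2.
suff : let t := exec (For 19 3 (tally_votes R;;
         If (rival_expr R) (If (beaten_expr R)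
         (If (ESub (EAdd ($6) (ENum 1)) ($18)) (Assign 9 (ENum 1)))))) s2 in
  env t 9 = if (sumn b <= k) && has (defeats R x m n p b) (iota 0 (env s2 3))
            then 1 else env s 9 by rewrite m2.
move=> t0.
apply: (for_rule (Inv := fun j t => env t 9 =
  if (sumn b <= k) && has (defeats R x m n p b) (iota 0 j) then 1 else env s 9)).
  by rewrite andbF.
move=> i t hi ti ag it.
have hpt : params x m n p k t.
  by apply: params_agree ag _ _ hp2; case: (R).
have t18 : env t 18 = sumn b by rewrite -sz; case: ag => -> //; case: (R).
have a3 : arr t 3 = arr s2 3 by case: ag => _ -> //; case: (R).
rewrite exec_seq; set t1 := exec (tally_votes R) t.
have ag1' : agree _ _ t t1 := exec_agree (tally_votes R) t.
have hpt1 : params x m n p k t1.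
  by apply: params_agree ag1' _ _ hpt; case: (R).
have u18 : env t1 18 = sumn b by rewrite -t18; case: ag1' => -> //; case: (R).
have u19 : env t1 19 = i by rewrite -ti; case: ag1' => -> //; case: (R).
have u9 : env t1 9 = env t 9 by case: ag1' => -> //; case: (R).
have [] := tally_votes_correct R (b := b) hpt; first by move=> u hu; rewrite a3 hd.
rewrite -/t1 ti => w1 w2.
have u5 : env t1 5 = p by case: hpt1 => [[]].
have u6 : env t1 6 = k by case: hpt1 => [[]].
have r0 : (eval t1 (rival_expr R) == 0) || (eval t1 (beaten_expr R) == 0)
    = ~~ defeats R x m n p b i.
  by case: (R) w1 w2 => w1 w2; rewrite /= ?u19 ?u5 w1 w2; lia.
have r1 : (eval t1 (ESub (EAdd $6 (ENum 1)) $18) == 0) = ~~ (sumn b <= k).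
  by rewrite /= u6 u18; lia.
rewrite iota_rcons has_rcons.
set e1 := rival_expr R in r0 *; set e2 := beaten_expr R in r0 *.
rewrite !exec_if r1; move: r0 it.
case: (sumn b <= k); case: eqP => _; case: eqP => _ /=;
  by case: (defeats R x m n p b i) => //= _; rewrite /upd /= ?u9.
Qed.

(** * The binary counter over sets of representatives *)

Definition code (w b : nat -> nat) (i : nat) : nat := sumn (mkseq (fun v => w v * b v) i).

Lemma codeS w b i : code w b i.+1 = code w b i + w i * b i.
Proof. by rewrite /code /mkseq iota_rcons map_rcons sumn_rcons. Qed.

Lemma eq_code w b b' i : (forall v, v < i -> b v = b' v) -> code w b i = code w b' i.
Proof.
elim: i => // i ih h; rewrite !codeS ih ?h // => v hv.
by rewrite h // ltnS ltnW.
Qed.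

Lemma code0 w i : code w (fun=> 0) i = 0.
Proof. by elim: i => // i ih; rewrite codeS ih muln0. Qed.

(** Only representatives contribute, the one of rank r with weight 2 ^ r, so this bounds a binary
    number with [rank x m n i] digits. *)
Lemma code_lt x m n b i :
  (forall v, v < i -> b v <= 1) -> code (weight x m n) b i < 2 ^ rank x m n i.
Proof.
elim: i => // i ih h; rewrite codeS rankS {2}/weight.
have {}ih := ih (fun v hv => h v (ltnW hv)).
have hi := h i (leqnn _).
case: is_rep; last by rewrite addn0 add0n.
rewrite /= add1n expnS; move: hi; case: (b i) => [|[|]] // _; lia.
Qed.

Definition representative_subset (x : nat -> nat) (m n : nat) (b : nat -> nat) : Prop :=
  forall v, v < n -> b v <= 1 /\ (~~ is_rep x m n v -> b v = 0).

(** Uniqueness of binary expansions: the lower digits sum to less than the top weight, so equal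
    codes force equal top digits. *)
Lemma code_inj x m n b b' :
  representative_subset x m n b -> representative_subset x m n b' ->
  code (weight x m n) b n = code (weight x m n) b' n ->
  forall v, v < n -> b v = b' v.
Proof.
move=> hb hb'; suff H i : i <= n ->
    code (weight x m n) b i = code (weight x m n) b' i -> forall v, v < i -> b v = b' v.
  exact: H.
elim: i => // i ih hi; rewrite !codeS.
have [b1 b2] := hb i hi; have [b1' b2'] := hb' i hi.
have l1 : code (weight x m n) b i < 2 ^ rank x m n i.
  by apply: code_lt => v hv; case: (hb v (ltn_trans hv hi)).
have l2 : code (weight x m n) b' i < 2 ^ rank x m n i.
  by apply: code_lt => v hv; case: (hb' v (ltn_trans hv hi)).
rewrite {2 4}/weight; case hr: (is_rep x m n i) => e v; last first.
  rewrite ltnS leq_eqVlt => /orP [/eqP -> |hv]; first by rewrite b2 ?b2' ?hr.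
  by apply: ih => //; [exact: ltnW | rewrite !addn0 in e].
have eb : b i = b' i.
  by move: b1 b1' e; case: (b i) => [|[|]] //; case: (b' i) => [|[|]] //; lia.
rewrite ltnS leq_eqVlt => /orP [/eqP -> //|hv].
apply: ih => //; first exact: ltnW.
by rewrite eb in e; apply: addIn e.
Qed.

Lemma next_subset_correct x m n s :
  env s 4 = n -> (forall v, v < n -> arr s 1 v = weight x m n v) ->
  representative_subset x m n (arr s 2) ->
  let t := exec next_subset s in
  [/\ env t 24 <= 1, representative_subset x m n (arr t 2) &
      code (weight x m n) (arr t 2) n + env t 24 * 2 ^ rank x m n n =
      code (weight x m n) (arr s 2) n + 1].
Proof.
move=> h4 hw hb; rewrite /next_subset exec_seq; set s1 := exec _ s; set t := exec _ s1.
(* On every prefix, the new value together with the outgoing carry is the old value plus 1; digits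
   beyond the prefix are still the old ones. *)
pose Inv i t := [/\ env t 24 <= 1, representative_subset x m n (arr t 2),
  (forall v, i <= v -> arr t 2 v = arr s 2 v) &
  code (weight x m n) (arr t 2) i + env t 24 * 2 ^ rank x m n i =
  code (weight x m n) (arr s 2) i + 1].
suff : Inv (env s1 4) t by rewrite [env s1 4]h4; case.
apply: for_rule; first by split.
move=> i {}t; rewrite [env _ _]h4 => hi ti ag [i1 i2 i3 i4].
rewrite /Inv !codeS rankS exec_if [eval _ _]/= ti.
have -> : arr t 1 i = weight x m n i by case: ag => _ -> //; rewrite hw.
have wi : weight x m n i = if is_rep x m n i then 2 ^ rank x m n i else 0 by [].
case hr: (is_rep x m n i) wi => wi; rewrite wi; last first.
  rewrite /= add0n !mul0n !addn0; split=> // v hv; apply: i3; exact: ltnW.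
rewrite expn_eq0 /= ti; case: eqP => [e24|n24] /=; rewrite /upd /= ?ti.
  rewrite e24 in i4 *; split=> //; first by move=> v hv; apply: i3; exact: ltnW.
  by rewrite i3 //; lia.
have e24 : env t 24 = 1 by lia.
rewrite e24 in i4; have [b1 _] := i2 i hi.
split=> //.
- move=> v hv; case: eqP => [->|_]; last exact: i2.
  by rewrite hr; split=> //; lia.
- by move=> v hv; rewrite gtn_eqF ?i3 // ltnW.
- rewrite eqxx (eq_code _ (b' := arr t 2)); last by move=> v hv; rewrite ltn_eqF.
  rewrite -(i3 i (leqnn _)) expnS; move: i4 b1.
  by case: (arr t 2 i) => [|[|]] //; lia.
Qed.

Lemma search_correct R x m n p k s :
  params x m n p k s -> env s 8 = 2 ^ rank x m n n -> env s 9 = 0 ->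
  (forall v, v < n -> arr s 1 v = weight x m n v /\ arr s 2 v = 0) ->
  let out := env (exec (search R) s) 9 in
  (out = 1 /\ exists2 b, representative_subset x m n b & success R x m n p k (mkseq b n)) \/
  (out = 0 /\ forall b, representative_subset x m n b -> ~~ success R x m n p k (mkseq b n)).
Proof.
move=> hp h8 h9 hs; rewrite /search; set t := exec _ s.
(* After [i] passes all sets of code below [i] have been tested and the current set has code [i].
   The guard [i < env s 8] is there because the last increment wraps around to 0. At the end
   [code_lt] shows that no set was missed. *)
pose Inv i t := [/\ representative_subset x m n (arr t 2),
   i < env s 8 -> code (weight x m n) (arr t 2) n = i,
   env t 9 <= 1,
   env t 9 = 1 -> exists2 b, representative_subset x m n b & success R x m n p k (mkseq b n) &
   forall b, representative_subset x m n b -> code (weight x m n) b n < i ->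
     success R x m n p k (mkseq b n) -> env t 9 = 1].
have : Inv (env s 8) t.
  apply: for_rule.
    split=> //=; rewrite /upd /= ?h9 //.
    - by move=> v /hs [_ ->].
    - move=> _; rewrite (eq_code _ (b' := fun=> 0)); last by move=> v /hs [_ ->].
      exact: code0.
  move=> i {}t hi ti ag [i1 i2 i3 i4 i5]; rewrite exec_seq.
  have hpt : params x m n p k t by apply: params_agree ag _ _ hp; case: (R).
  set t1 := exec (test_subset R) t; set t2 := exec next_subset t1.
  have ag1 : agree _ _ t t1 := exec_agree (test_subset R) t.
  have ag2 : agree _ _ t1 t2 := exec_agree next_subset t1.
  have hp1 : params x m n p k t1 by apply: params_agree ag1 _ _ hpt; case: (R).
  have n1 : env t1 4 = n by case: hp1 => [[]].
  have a1 : arr t1 1 = arr s 1.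
    by case: ag1 => _ ->; [case: ag => _ -> //; case: (R) | case: (R)].
  have a2 : arr t1 2 = arr t 2 by case: ag1 => _ -> //; case: (R).
  have w1 v : v < n -> arr t1 1 v = weight x m n v by rewrite a1 => /hs [].
  have b1 : representative_subset x m n (arr t1 2) by rewrite a2.
  have [c1 c2 c3] := next_subset_correct n1 w1 b1; rewrite -/t2 a2 in c1 c2 c3.
  have o2 : env t2 9 = if success R x m n p k (mkseq (arr t 2) n) then 1 else env t 9.
    by case: ag2 => -> // _; exact: test_subset_correct.
  rewrite i2 // in c3.
  split; rewrite /= /upd /= ?o2 //.
  - by move=> hi'; move: c3 c1; rewrite -h8; case: (env t2 24) => [|[|]] //; lia.
  - by case: ifP.
  - case: ifP => // hsucc _; by exists (arr t 2).
  - move=> b hb; rewrite ltnS leq_eqVlt => /orP [/eqP hc|hc] hsucc; last first.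
      by case: ifP => // _; apply: i5 hsucc.
    (* By [code_inj] the set of code [i] is the one that has just been tested. *)
    suff -> : mkseq (arr t 2) n = mkseq b n by rewrite hsucc.
    apply/eq_in_map => v; rewrite mem_iota /= => hv.
    by apply: (code_inj i1 hb) => //; rewrite i2 // hc.
case=> _ _ o1 o2 o3; case: (posnP (env t 9)) => ho; last first.
  have e1 : env t 9 = 1 by lia.
  by left; split=> //; apply: o2.
right; split=> // b hb; apply/negP => hsucc.
suff : env t 9 = 1 by rewrite ho.
apply: o3 hsucc => //; rewrite h8; apply: code_lt => v /hb; by case.
Qed.

(** * Correctness with respect to the encoded instance *)

Lemma nth_flatten_const (ss : seq (seq nat)) (w r c : nat) :
  all (fun s => size s == w) ss -> r < size ss -> c < w ->
  nth 0 (flatten ss) (w * r + c) = nth 0 (nth [::] ss r) c.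
Proof.
elim: ss r => //= s ss ih [|r] /andP [/eqP hs hss] hr hc; rewrite nth_cat hs.
  by rewrite muln0 add0n hc.
have -> : (w * r.+1 + c < w) = false by rewrite mulnS; lia.
by rewrite mulnS -addnA addnC addnK ih.
Qed.

Lemma size_flatten_const (ss : seq (seq nat)) (w : nat) :
  all (fun s => size s == w) ss -> size (flatten ss) = w * size ss.
Proof.
elim: ss => [|s ss ih] /=; first by rewrite muln0.
by case/andP=> /eqP hs hss; rewrite size_cat hs ih // mulnS.
Qed.

Lemma count_ord n (P : pred nat) : count P (iota 0 n) = #|[set u : 'I_n | P u]|.
Proof.
rewrite -val_enum_ord count_map cardsE cardE -size_filter; congr size.
by rewrite [in RHS]/enum_mem -enumT.
Qed.

Lemma has_ord n (P : pred nat) : has P (iota 0 n) = [exists u : 'I_n, P u].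
Proof.
apply/hasP/existsP => [[u]|[u hu]].
  by rewrite mem_iota /= => hu hP; exists (Ordinal hu).
by exists (val u); rewrite ?mem_iota /=.
Qed.

Lemma all_ord n (P : pred nat) : all P (iota 0 n) = [forall u : 'I_n, P u].
Proof.
by rewrite -[LHS]negbK -has_predC has_ord negb_exists; apply: eq_forallb => u; rewrite /= negbK.
Qed.

Lemma foldl_last (P : pred nat) (j n : nat) :
  j < n -> (forall i, i < n -> P i = (i == j)) ->
  foldl (fun a i => if P i then i else a) 0 (iota 0 n) = j.
Proof.
move=> hj hP.
suff H i : i <= n -> foldl (fun a i => if P i then i else a) 0 (iota 0 i) =
    if j < i then j else 0 by rewrite H // hj.
elim: i => // i ih hi; rewrite iota_rcons foldl_rcons hP // ih; last exact: ltnW.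
by rewrite ltnS; case: ltngtP.
Qed.

Definition input (I : instance) : nat -> nat := fun j => nth 0 (encode I) j.

Lemma size_prefs (I : instance) :
  all (fun s => size s == inst_m I)
    [seq [seq val (inst_pref I v i) | i <- enum 'I_(inst_m I)] | v <- enum 'I_(inst_n I)].
Proof. by apply/allP => s /mapP [v _ ->]; rewrite size_map size_enum_ord. Qed.

Lemma size_bundles (I : instance) :
  all (fun s => size s == inst_n I)
    [seq [seq nat_of_bool (u \in inst_kappa I v) | u <- enum 'I_(inst_n I)]
    | v <- enum 'I_(inst_n I)].
Proof. by apply/allP => s /mapP [v _ ->]; rewrite size_map size_enum_ord. Qed.

Lemma size_encode I : size (encode I) = 4 + inst_m I * inst_n I + inst_n I * inst_n I.
Proof.
rewrite /encode !size_cat (size_flatten_const (size_prefs I)).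
rewrite (size_flatten_const (size_bundles I)) 2!size_map.
by rewrite size_enum_ord addnA.
Qed.

Lemma nth_encode (I : instance) j :
  nth 0 (encode I) (4 + j) =
  nth 0 (flatten [seq [seq val (inst_pref I v i) | i <- enum 'I_(inst_m I)]
                 | v <- enum 'I_(inst_n I)] ++
         flatten [seq [seq nat_of_bool (u \in inst_kappa I v) | u <- enum 'I_(inst_n I)]
                 | v <- enum 'I_(inst_n I)]) j.
Proof. by []. Qed.

Lemma input_pref (I : instance) (v : 'I_(inst_n I)) (i : 'I_(inst_m I)) :
  input I (4 + inst_m I * v + i) = inst_pref I v i.
Proof.
rewrite /input -addnA nth_encode nth_cat.
rewrite (size_flatten_const (size_prefs I)) size_map size_enum_ord.
have -> : (inst_m I * v + i < inst_m I * inst_n I) = true.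
  have := ltn_ord v; have := ltn_ord i; nia.
rewrite (nth_flatten_const (size_prefs I)) // 1?size_map ?size_enum_ord //.
rewrite (nth_map v) ?size_enum_ord // (nth_map i) ?size_enum_ord //.
by rewrite !nth_ord_enum.
Qed.

Lemma input_bundle (I : instance) (v u : 'I_(inst_n I)) :
  bundled (input I) (inst_m I) (inst_n I) v u = (u \in inst_kappa I v).
Proof.
rewrite /bundled /input -!addnA nth_encode nth_cat.
rewrite (size_flatten_const (size_prefs I)) size_map size_enum_ord mulnC.
rewrite ltnNge leq_addr /= addKn.
rewrite (nth_flatten_const (size_bundles I)) // 1?size_map ?size_enum_ord //.
rewrite (nth_map v) ?size_enum_ord // (nth_map u) ?size_enum_ord //.
by rewrite !nth_ord_enum.
Qed.

Lemma position_input (I : instance) (v : 'I_(inst_n I)) (c : 'I_(inst_m I)) :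
  position (input I) (inst_m I) v c = pos (inst_pref I) v c.
Proof.
apply: foldl_last => [|i hi]; first exact: ltn_ord.
rewrite (input_pref v (Ordinal hi)) /pos.
apply/eqP/eqP => [/ord_inj <-|h]; first by rewrite permK.
have -> : Ordinal hi = (inst_pref I v)^-1%g c by apply: ord_inj.
by rewrite permKV.
Qed.

Definition support_set (n : nat) (b : nat -> nat) : {set 'I_n} := [set v : 'I_n | b v != 0].

Lemma deleted_input (I : instance) (b : nat -> nat) (u : 'I_(inst_n I)) :
  deleted (input I) (inst_m I) (inst_n I) (mkseq b (inst_n I)) u =
  (u \in bundle_union (inst_kappa I) (support_set (inst_n I) b)).
Proof.
rewrite /deleted has_ord; apply/existsP/bigcupP => [[v]|[v hv huv]].
  rewrite nth_mkseq // input_bundle => /andP [hv huv]; exists v; rewrite ?inE //.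
  by move: huv; case: (u \in _).
by exists v; rewrite nth_mkseq // input_bundle huv andbT; rewrite inE in hv.
Qed.

Lemma tally_input (I : instance) R (b : nat -> nat) (c d : 'I_(inst_m I)) :
  let W := ~: bundle_union (inst_kappa I) (support_set (inst_n I) b) in
  tally R (input I) (inst_m I) (inst_n I) (mkseq b (inst_n I)) c d =
  match R with
  | Plurality => plurality_score (inst_pref I) W c
  | Condorcet => #|[set v in W | prefers (inst_pref I) v c d]|
  end.
Proof.
rewrite /tally count_ord.
by case: R; apply: eq_card => v; rewrite !inE deleted_input !position_input.
Qed.

(** Digits at most 1 make the sum of [b] the size of its support. *)
Lemma success_input (I : instance) R (b : nat -> nat) :
  (forall v, v < inst_n I -> b v <= 1) ->
  let V := support_set (inst_n I) b in
  reflect (#|V| <= inst_k I /\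
    ~ is_winner R (inst_pref I) (~: bundle_union (inst_kappa I) V) (inst_p I))
  (success R (input I) (inst_m I) (inst_n I) (inst_p I) (inst_k I) (mkseq b (inst_n I))).
Proof.
move=> hb V; rewrite /success.
have -> : sumn (mkseq b (inst_n I)) = #|V|.
  rewrite -(count_ord _ (fun v => b v != 0)) -sumn_count; congr sumn.
  by apply/eq_in_map => v; rewrite mem_iota /= => /hb; case: (b v) => [|[]].
rewrite has_ord.
apply: (iffP andP) => -[hk h]; split=> //.
  case/existsP: h => c; rewrite /defeats; case: R.
    by rewrite !tally_input => hc /(_ c); rewrite leqNgt hc.
  by case/andP=> hcp; rewrite !tally_input => hc /(_ c hcp); rewrite ltnNge hc.
(* Winning quantifies over finitely many rivals: if no candidate defeats p, then p wins. *)
apply: contraT => /existsPn hn; case: h.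
case: R hn => hn c; rewrite leqNgt.
  by have := hn c; rewrite /defeats !tally_input.
move=> hc; have := hn c; rewrite /defeats !tally_input /= negb_and -ltnNge.
by rewrite (inj_eq (@ord_inj _)) hc.
Qed.

Lemma is_rep_input (I : instance) (v : 'I_(inst_n I)) :
  is_rep (input I) (inst_m I) (inst_n I) v =
  [forall u : 'I_(inst_n I), (u < v) ==> (inst_kappa I u != inst_kappa I v)].
Proof.
rewrite /is_rep has_ord negb_exists; apply: eq_forallb => u.
rewrite negb_and implybE; congr (_ || ~~ _).
rewrite /same_row all_ord; apply/forallP/eqP => [h|h w].
  apply/setP => w; have := h w; rewrite !input_bundle.
  by case: (w \in _); case: (w \in _).
by rewrite !input_bundle h.
Qed.

Lemma CDesDel_success (I : instance) R :
  CDesDel R I <-> exists2 b, representative_subset (input I) (inst_m I) (inst_n I) b &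
    success R (input I) (inst_m I) (inst_n I) (inst_p I) (inst_k I) (mkseq b (inst_n I)).
Proof.
split=> [[V [hk hw]]|[b hb]]; last first.
  have hb1 v (hv : v < inst_n I) : b v <= 1 by case: (hb v hv).
  by move=> /(success_input R hb1) [h1 h2]; exists (support_set (inst_n I) b).
(* The voter of least index with a given bundle is the one that [is_rep] selects. *)
pose r (v : 'I_(inst_n I)) := [arg min_(u < v | inst_kappa I u == inst_kappa I v) val u].
have rP v : inst_kappa I (r v) = inst_kappa I v /\
    forall u : 'I_(inst_n I), u < r v -> inst_kappa I u != inst_kappa I v.
  rewrite /r; case: arg_minnP => [|u /eqP hu hmin]; first exact: eqxx.
  by split=> // u' hu'; apply/negP => /hmin; rewrite leqNgt hu'.
pose b (j : nat) : nat := [exists v in r @: V, val v == j].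
have bE (v : 'I_(inst_n I)) : b v = (v \in r @: V).
  congr nat_of_bool; apply/existsP/idP => [[u /andP [hu /eqP /ord_inj <-]]|hv] //.
  by exists v; rewrite hv eqxx.
have hV : support_set (inst_n I) b = r @: V.
  by apply/setP => v; rewrite inE bE; case: (v \in _).
have hU : bundle_union (inst_kappa I) (r @: V) = bundle_union (inst_kappa I) V.
  apply/setP => u; apply/bigcupP/bigcupP => -[v].
    by case/imsetP=> w hw' ->; rewrite (rP w).1 => hu; exists w.
  by move=> hv hu; exists (r v); rewrite ?imset_f ?(rP v).1.
exists b.
  move=> v hv; split; first by rewrite /b; case: [exists _ in _, _].
  apply: contraNeq => bv; rewrite (is_rep_input (Ordinal hv)).
  have /imsetP [w _ ->] : Ordinal hv \in r @: V.
    by move: bv; rewrite (bE (Ordinal hv)); case: (_ \in _).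
  apply/forallP => u; apply/implyP => hu; rewrite (rP w).1; exact: (rP w).2.
apply/success_input; first by move=> v _; rewrite /b; case: [exists _ in _, _].
by rewrite hV hU; split=> //; apply: leq_trans (leq_imset_card _ _) hk.
Qed.

(** Two distinct representatives with the same order would have equal bundles by anonymity, and the
    later one would not be a representative. So the preference map is injective on representatives,
    with values in the m! permutations. *)
Lemma rank_le_fact (I : instance) :
  anonymous (inst_pref I) (inst_kappa I) ->
  rank (input I) (inst_m I) (inst_n I) (inst_n I) <= (inst_m I)`!.
Proof.
move=> hanon; rewrite /rank count_ord -(card_in_imset (f := inst_pref I)).
  by rewrite -card_Sn; apply: max_card.
move=> u v; rewrite !inE !is_rep_input => /forallP hu /forallP hv huv.
apply/eqP; apply: contraT => ne; have [hk _] := hanon u v ne huv.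
have := hu v; have := hv u; rewrite hk eqxx /= !implybF -!leqNgt => h1 h2.
by rewrite -(inj_eq (@ord_inj _)) eqn_leq h1 h2 in ne.
Qed.

(** In the induction step the new factor satisfies m + 1 <= 2 ^ m <= 2 ^ 2 ^ m, and squaring 2 ^ 2 ^
    m raises the inner exponent by one. *)
Lemma fact_le_exp2exp2 m : m`! <= 2 ^ 2 ^ m.
Proof.
elim: m => // m ih; rewrite factS expnS mul2n -addnn expnD leq_mul //.
by apply: leq_trans (ltn_expl m (ltnSn 1)) (ltnW (ltn_expl _ (ltnSn 1))).
Qed.

(** * Running time *)

(** Comparing all pairs of rows is cubic in the number n of voters, and n ^ 2 <= L because the
    bundling matrix is part of the input; hence n ^ 3 <= L ^ 2. *)
Lemma cost_representatives r L :
  0 < L -> r 4 * r 4 <= L -> r 4 <= L -> cost representatives r <= 1000 * (L * L).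
Proof.
move=> hL hn2 hn.
have h3 : r 4 * r 4 * r 4 <= L * L by rewrite leq_mul.
have h2 : r 4 * r 4 <= L * L by rewrite leq_mul.
have h1 : r 4 * 1 <= L * L by rewrite leq_mul.
have h0 : 0 < L * L by rewrite muln_gt0 hL.
by rewrite /=; lia.
Qed.

(** Per subset, marking costs about n ^ 3 and the tallies about m * (m * n); since m * n <= L, both
    fit into (m + 1) * L ^ 2. *)
Lemma cost_search R r L :
  0 < L -> r 3 * r 4 <= L -> r 4 * r 4 <= L -> r 4 <= L -> 0 < r 8 ->
  cost (search R) r <= 2000 * ((r 8 * (r 3).+1) * (L * L)).
Proof.
move=> hL hmn hn2 hn hc.
have h3 : r 4 * r 4 * r 4 <= L * L by rewrite leq_mul.
have h2 : r 4 * r 4 <= L * L by rewrite leq_mul.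
have h1 : r 4 * 1 <= L * L by rewrite leq_mul.
have h0 : 1 <= L * L by rewrite muln_gt0 hL.
have g1 : r 3 * r 4 * 1 <= L * L by rewrite leq_mul.
have g2 : r 3 * (r 3 * r 4 * 1) <= r 3 * (L * L) by rewrite leq_mul.
have g3 : r 3 * 1 <= r 3 * (L * L) by rewrite leq_mul.
have inner : cost (test_subset R;; next_subset) r + 6 <= 1000 * ((r 3).+1 * (L * L)).
  by case: R; rewrite /=; lia.
have := leq_mul (leqnn (r 8)) inner.
have p1 : 1 <= r 8 * (r 3).+1 * (L * L) by rewrite !muln_gt0 hc hL.
have -> : cost (search R) r = r 8 * (cost (test_subset R;; next_subset) r + 6) + 3 by [].
by move: (cost _ _ + 6) => z; lia.
Qed.

Definition power_of_two (z y : nat) : cmd :=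
  Assign z (ENum 1);; For 12 y (Assign z (EAdd ($z) ($z))).

Lemma power_of_two_correct z y s :
  z != 12 -> y != z -> env (exec (power_of_two z y) s) z = 2 ^ env s y.
Proof.
move=> hz hy; rewrite /power_of_two exec_seq; set s1 := exec _ s.
rewrite (_ : env s y = env s1 y); last by rewrite /s1 /= /upd (negPf hy).
apply: (for_rule (Inv := fun i t => env t z = 2 ^ i)).
  by rewrite /= /upd (negPf hz) eqxx.
by move=> i t _ _ _ it; rewrite /= /upd (negPf hz) eqxx it addnn -mul2n expnS.
Qed.

(** Each power of two is the loop bound for the next one, which is why these are separate commands
    of a list. *)
Definition bound_program : seq cmd :=
  [:: Assign 3 (EGet 0 (ENum 0)); power_of_two 4 3; power_of_two 5 4; power_of_two 6 5;
      Assign 7 (EAdd ($3) (ENum 1));; Assign 8 (ENum 0); addmul 8 6 7].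

Lemma computable_bound : computable (fun m => 2 ^ 2 ^ 2 ^ m * m.+1).
Proof.
exists (compile bound_program 8) => m.
have [t [s [hx _ h]]] := compile_correct (cs := bound_program) (out := 8)
  (input := [:: m]) isT isT isT.
exists t; suff <- : env (execs bound_program s) 8 = 2 ^ 2 ^ 2 ^ m * m.+1 by [].
have -> : execs bound_program s = exec (addmul 8 6 7)
    (exec (Assign 7 (EAdd ($3) (ENum 1));; Assign 8 (ENum 0)) (exec (power_of_two 6 5)
      (exec (power_of_two 5 4) (exec (power_of_two 4 3) (exec (Assign 3 (EGet 0 (ENum 0))) s))))) by [].
set s1 := exec (Assign 3 _) _; set s2 := exec (power_of_two 4 3) s1.
set s3 := exec (power_of_two 5 4) s2; set s4 := exec (power_of_two 6 5) s3.
have e1 : env s1 3 = m by rewrite /s1 /= /upd /= hx.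
have e2 : env s2 4 = 2 ^ m by rewrite /s2 power_of_two_correct // e1.
have e3 : env s3 5 = 2 ^ 2 ^ m by rewrite /s3 power_of_two_correct // e2.
have e4 : env s4 6 = 2 ^ 2 ^ 2 ^ m by rewrite /s4 power_of_two_correct // e3.
have e5 : env s4 3 = m.
  have [-> // _] := exec_agree (power_of_two 6 5) s3.
  have [-> // _] := exec_agree (power_of_two 5 4) s2.
  by have [-> // _] := exec_agree (power_of_two 4 3) s1.
by rewrite addmul_correct // exec_seq !exec_assign /= /upd /= e4 e5 add0n addn1 mulnC.
Qed.

Theorem theorem11 :
  forall R : voting_rule,
    FPT (CDesDel R)
        (fun I => is_bundling (inst_kappa I) /\
                  anonymous (inst_pref I) (inst_kappa I))
        inst_m.
Proof.
(* Of the exponent 9, two come from the quadratic costs; the other seven absorb the constants, as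
   [L] is at least 4 and 4 ^ 7 exceeds 576 + 43 + 1000 + 2000. *)
move=> R; exists (compile (solver R) 9), (fun m => 2 ^ 2 ^ 2 ^ m * m.+1), 9.
split=> [|I [_ hanon]]; first exact: computable_bound.
set m := inst_m I; set n := inst_n I; set L := size (encode I).
have sL : L = 4 + m * n + n * n := size_encode I.
have hL : 0 < L by rewrite sL.
have [t [s [hx ht hrun]]] := compile_correct (wf_solver R) (isT : isvar 9) hL.
pose s1 := exec setup s; pose s2 := exec representatives s1.
have h1 : [/\ env s1 3 = m, env s1 4 = n, env s1 5 = inst_p I & env s1 6 = inst_k I].
  by rewrite /s1 /= /upd /= !hx.
have [hp h8 h12] := representatives_correct h1 hx; rewrite -/s2 in hp h8 h12.
have h9 : env s2 9 = 0 by have [-> // _] := exec_agree representatives s1.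
exists t, (env (execs (solver R) s) 9); split.
  apply: leq_trans ht _.
  have hn : n <= L by rewrite sL; nia.
  have hnn : n * n <= L by rewrite sL; lia.
  have hmn : m * n <= L by rewrite sL; lia.
  have [_ e14 _ _] := h1; have [[e23 e24 _ _ _] _] := hp.
  have c1 : cost representatives (env s1) <= 1000 * (L * L).
    by apply: cost_representatives; rewrite ?e14.
  have c2 : cost (search R) (env s2) <= 2000 * ((2 ^ 2 ^ 2 ^ m * m.+1) * (L * L)).
    apply: leq_trans (cost_search (L := L) R hL _ _ _ _) _; rewrite ?e23 ?e24 ?h8 ?expn_gt0 //.
    apply: leq_mul => //; apply: leq_mul => //; apply: leq_mul => //.
    by rewrite leq_exp2l // (leq_trans (rank_le_fact hanon)) // fact_le_exp2exp2.
  have -> : costs (solver R) s =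
    cost setup (env s) + (cost representatives (env s1) + (cost (search R) (env s2) + 0)) by [].
  have c0 : cost setup (env s) = 43 by [].
  have l7 : 4 ^ 7 <= L ^ 7 by rewrite leq_exp2r // sL -addnA leq_addr.
  rewrite (expnD L 2 7) mulnA; apply: leq_trans (leq_mul (leqnn _) l7).
  set F := 2 ^ 2 ^ 2 ^ m * m.+1 in c2 *.
  have hF : 0 < F by rewrite muln_gt0 expn_gt0.
  have LL : L <= F * L ^ 2 by rewrite -[L in X in X <= _]mul1n -mulnn mulnA leq_mul //; nia.
  have L2 : L * L <= F * L ^ 2 by rewrite mulnn leq_pmull.
  have L3 : F * (L * L) = F * L ^ 2 by rewrite mulnn.
  rewrite L3 in c2; rewrite c0 -/L.
  move: (F * L ^ 2) (L * L) (cost representatives _) (cost (search R) _) LL L2 c1 c2.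
  move=> X Y Z W; lia.
split; first exact: hrun.
have -> : execs (solver R) s = exec (search R) s2 by [].
have := search_correct R hp h8 h9 h12; rewrite /m /n CDesDel_success.
case=> [[ho hb]|[ho hb]]; [left|right]; split=> //.
by case=> b /hb /negP.
Qed.
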